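(* Let $\kappa=\kappa_m>0$ satisfy $\kappa/m \to \bar\kappa <1$, as $m\to\infty$. Let $L=(L_1,\ldots,L_n)$ be the stationary vector of single-server queue lengths in the homogeneous closed network with $m$ customers, $n$ single-server queues and parameter $\kappa$, and let $L_\vee=\max_i L_i$. For fixed $n \in \mathbb{N}$, the vector $(m-\kappa)^{-1} L$ converges in distribution to $X$, as $m\to\infty$, where $X$ is uniformly distributed on the unit simplex of nonnegative reals $\Delta^n=\{x \in [0,\infty)^n:\, |x|=1\}$. The moments of $(m-\kappa)^{-1} L_\vee$ converge to the moments of $X_\vee=\max_i X_i$. In particular, as $m\to\infty$, \begin{align*} \frac{n}{m-\kappa}\, \mathbb{E} L_\vee &\to H_1(n), \\ \frac{n^2}{(m-\kappa)^2}\operatorname{Var}(L_\vee) &\to \frac{n H_2(n) - H^2_1(n)}{n+1}. \end{align*} Moreover, as $n\to\infty$, \[ \lim_{m\to\infty}\Pr\left[\frac{n}{m-\kappa} L_\vee \leq x + \ln n \right] = \Pr[nX_\vee \leq x + \ln n] \to e^{-e^{-x}}. \]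
   Context: Model: a closed network with $m$ customers, one infinite-server node and $n$ infinite-buffer single-server queues. Service times at the infinite-server node are exponential with rate $\lambda$; after service there, a customer is routed to single-server queue $i$ with probability $p_i>0$, $\sum_{i=1}^n p_i=1$; service times at queue $i$ are exponential with rate $\mu_i$; all service times are independent; after service at a single-server queue the customer rejoins the infinite-server node. The network is homogeneous: $\kappa^{-1}=p_i\lambda/\mu_i$ for all $i$. Its stationary distribution of the single-server queue lengths is \[ \pi(l)=\Pr[L=l]=c_{m,n}^{-1}\, m!\,\frac{\kappa^{-|l|}}{(m-|l|)!},\qquad l\in\{0,1,2,\ldots\}^n,\ |l|:=l_1+\cdots+l_n\le m, \] where $c_{m,n}$ is the normalization constant, and $L=(L_1,\ldots,L_n)$ is a random vector distributed according to $\pi$. For a real vector $x$, $|x|=|x_1|+\cdots+|x_n|$. For $k\in\{1,2\}$, $H_k(n):=\sum_{i=1}^n i^{-k}$, and $H_1^2(n)=(H_1(n))^2$.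
   Formalization: In the last display the identity of the limit in m with Pr[nX_∨ ≤ x + ln n] is stated for all n and x except n = 1, x = 1, where it fails: X_∨ = 1 is an atom there, and for κ = m/2 the left side tends to 1/2, not 1. *)

(* Defs.v *)
From HB Require Import structures.
From mathcomp Require Import all_boot all_order all_algebra.
From mathcomp Require Import all_classical all_reals all_analysis.
From mathcomp Require Import ring.

Set Implicit Arguments.
Unset Strict Implicit.
Unset Printing Implicit Defensive.

Import Order.TTheory GRing.Theory Num.Theory.
Import numFieldNormedType.Exports.

Local Open Scope classical_set_scope.
Local Open Scope ring_scope.

(* The [m - |l|] customers outside the single-server queues are at the
   infinite-server node. *)
Definition state (n m : nat) : Type :=
  {l : {ffun 'I_n -> 'I_m.+1} | (\sum_(i < n) l i <= m)%N}.

Definition qlen n m (l : state n m) (i : 'I_n) : nat := val l i.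

Definition qtotal n m (l : state n m) : nat := (\sum_(i < n) qlen l i)%N.

Definition qmax n m (l : state n m) : nat := (\max_(i < n) qlen l i)%N.

Definition incr_queue n m (i : 'I_n) (l l' : state n m) : bool :=
  [forall j : 'I_n, qlen l' j == (qlen l j + (j == i))%N].

(* Jump rates of the Markov process of the single-server queue lengths: a
   departure from the infinite-server node joins queue [i] with probability
   [p i]; a departure from queue [i] joins the infinite-server node. *)
Definition network_rate (R : realType) n m (lam : R) (p mu : 'I_n -> R)
    (l l' : state n m) : R :=
  \sum_(i < n) ((m - qtotal l)%:R * lam * p i *+ incr_queue i l l'
                + mu i *+ incr_queue i l' l).

Definition homogeneous_network (R : realType) n (lam : R) (p mu : 'I_n -> R)
    (kappa : R) : Prop :=
  [/\ 0 < lam,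
      (forall i, 0 < p i) /\ \sum_(i < n) p i = 1,
      (forall i, 0 < mu i) &
      forall i, kappa^-1 = p i * lam / mu i].

Definition stationary_distribution (R : realType) (S : finType)
    (q : S -> S -> R) (nu : S -> R) : Prop :=
  [/\ forall s, 0 <= nu s,
      \sum_s nu s = 1 &
      forall s, nu s * \sum_s' q s s' = \sum_s' nu s' * q s' s].

Definition stationary_queue_lengths (R : realType) n m (lam : R)
    (p mu : 'I_n -> R) d (T : measurableType d) (P : probability T R)
    (L : T -> state n m) : Prop :=
  (forall l, measurable (L @^-1` [set l])) /\
  stationary_distribution (network_rate (m := m) lam p mu)
    (fun l => fine (P (L @^-1` [set l]))).

Definition stationary_weight (R : realType) n m (kappa : R) (l : state n m)
    : R :=
  m`!%:R * kappa ^- qtotal l / (m - qtotal l)`!%:R.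

Definition stationary_pmf (R : realType) n m (kappa : R) (l : state n m) : R :=
  (\sum_(l' : state n m) stationary_weight kappa l')^-1
  * stationary_weight kappa l.

Lemma incr_qtotal n m (i : 'I_n) (l l' : state n m) :
  incr_queue i l l' -> qtotal l' = (qtotal l).+1.
Proof.
move=> /forallP h; rewrite /qtotal.
have -> : (\sum_j qlen l' j = \sum_j (qlen l j + (j == i)))%N.
  by apply: eq_bigr => j _; apply/eqP/h.
rewrite big_split/= (_ : \sum_j (j == i) = 1)%N ?addn1//.
by rewrite (bigD1 i)//= eqxx big1// => j /negPf ->.
Qed.

Lemma qtotal_le n m (l : state n m) : (qtotal l <= m)%N.
Proof. exact: (valP l). Qed.

Lemma stationary_weight_gt0 (R : realType) n m (kappa : R) (l : state n m) :
  0 < kappa -> 0 < stationary_weight kappa l.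
Proof.
move=> k0; rewrite /stationary_weight divr_gt0 ?mulr_gt0 ?invr_gt0 ?exprn_gt0//;
  by rewrite ltr0n fact_gt0.
Qed.

Lemma detailed_balance (R : realType) n m (lam kappa : R) (p mu : 'I_n -> R)
    (l l' : state n m) : 0 < kappa -> homogeneous_network lam p mu kappa ->
  stationary_weight kappa l * network_rate lam p mu l l'
  = stationary_weight kappa l' * network_rate lam p mu l' l.
Proof.
move=> k0 [_ _ mu0 hk].
have half i (a b : state n m) : incr_queue i a b ->
    stationary_weight kappa a * ((m - qtotal a)%:R * lam * p i)
    = stationary_weight kappa b * mu i.
  move=> /incr_qtotal hab; rewrite /stationary_weight hab.
  have hm : (qtotal a < m)%N by rewrite -hab qtotal_le.
  have -> : (m - qtotal a = (m - (qtotal a).+1).+1)%N by rewrite -subSn.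
  set k := (m - _)%N; rewrite factS natrM exprS.
  have muE : mu i = p i * lam * kappa.
    have := hk i; have := lt0r_neq0 (mu0 i); have := lt0r_neq0 k0 => k1 m1 e.
    by apply: (mulfI (invr_neq0 m1)); rewrite mulVf// mulrA [_^-1 * _]mulrC -e mulVf.
  have f0 : k`!%:R != 0 :> R by rewrite pnatr_eq0 -lt0n fact_gt0.
  have s0 : k.+1%:R != 0 :> R by rewrite pnatr_eq0.
  have kq : kappa ^+ qtotal a != 0 by rewrite expf_neq0 // lt0r_neq0.
  have kn : kappa != 0 by rewrite lt0r_neq0.
  by rewrite muE; field; rewrite f0 kq kn nat1r s0.
rewrite /network_rate !mulr_sumr; apply: eq_bigr => i _; rewrite !mulrDr addrC.
congr (_ + _).
  by case: (boolP (incr_queue i l' l)) => [h|_]; rewrite ?mulr0n ?mulr0// !mulr1n (half _ _ _ h).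
by case: (boolP (incr_queue i l l')) => [h|_]; rewrite ?mulr0n ?mulr0// !mulr1n (half _ _ _ h).
Qed.

Lemma stationary_distributionE (R : realType) n m (lam kappa : R)
    (p mu : 'I_n -> R) (nu : state n m -> R) :
  0 < kappa -> homogeneous_network lam p mu kappa ->
  stationary_distribution (network_rate lam p mu) nu
  <-> nu =1 stationary_pmf kappa.
Proof.
move=> k0 hom; have [lam0 [p0 _] mu0 _] := hom.
set q := network_rate lam p mu; pose w := @stationary_weight R n m kappa.
have w0 l : 0 < w l by exact: stationary_weight_gt0.
have wn l : w l != 0 by rewrite lt0r_neq0.
have db l l' : w l * q l l' = w l' * q l' l by exact: detailed_balance.
have q_ge0 l l' : 0 <= q l l'.
  apply: sumr_ge0 => i _; rewrite addr_ge0// mulrn_wge0//; last exact: ltW.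
  by rewrite !mulr_ge0// ltW.
have z0 : state n m.
  exists [ffun=> ord0]; by rewrite big1// => i _; rewrite ffunE.
have W0 : 0 < \sum_l w l.
  by rewrite (bigD1 z0)//= ltr_pwDl// sumr_ge0// => l _; rewrite ltW.
split=> [[nu0 nu1 bal]|E]; last first.
  split=> [l||l].
  - by rewrite E mulr_ge0 ?invr_ge0 ?ltW.
  - under eq_bigr do rewrite E /stationary_pmf.
    by rewrite -mulr_sumr mulVf// lt0r_neq0.
  - rewrite E /stationary_pmf mulr_sumr; apply: eq_bigr => l' _.
    by rewrite E /stationary_pmf -[LHS]mulrA -[RHS]mulrA; congr (_ * _); exact: db.
pose h l := nu l / w l.
have nuE l : nu l = h l * w l by rewrite /h divfK.
have harm l : \sum_l' q l l' * (h l' - h l) = 0.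
  apply: (mulfI (wn l)); rewrite mulr0 mulr_sumr.
  transitivity (\sum_l' nu l' * q l' l - nu l * \sum_l' q l l').
    rewrite [X in _ - X]mulr_sumr -sumrB; apply: eq_bigr => l' _.
    by rewrite !nuE -(mulrA _ (w l')) -db; ring.
  by rewrite bal subrr.
have down k (f : state n m -> R) (l : state n m) : qtotal l = k ->
    (forall l, \sum_l' q l l' * (f l' - f l) = 0) ->
    (forall l', f l' <= f l) ->
    exists2 z : state n m, qtotal z = 0%N & f z = f l.
  move=> + Hf; elim: k l => [|k IH] l lk lmax; first by exists l.
  have [i li] : exists i, (0 < qlen l i)%N.
    apply/existsP; apply: contraT => /existsPn a0.
    move: lk; rewrite /qtotal big1// => i _.
    by apply/eqP; move: (a0 i); rewrite lt0n negbK.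
  pose g := [ffun j => if j == i then inord (qlen l i).-1 else val l j].
  have gE j : (g j = qlen l j - (j == i) :> nat)%N.
    rewrite ffunE; case: eqP => [->|_]; last by rewrite subn0.
    rewrite inordK ?subn1//.
    by rewrite (leq_ltn_trans (leq_pred _))// /qlen ltn_ord.
  have gm : (\sum_j g j <= m)%N.
    apply: leq_trans (qtotal_le l); apply: leq_sum => j _.
    by rewrite gE leq_subr.
  pose l' : state n m := exist _ g gm.
  have up : incr_queue i l' l.
    apply/forallP => j; rewrite [qlen l' j]gE subnK//.
    by case: eqP => [->|].
  have ql : 0 < q l l'.
    rewrite /q /network_rate (bigD1 i)//= up mulr1n.
    apply: ltr_pwDl; last first.
      apply: sumr_ge0 => j _.
      by rewrite addr_ge0// mulrn_wge0// ?mulr_ge0// ltW.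
    by rewrite ltr_wpDl// mulrn_wge0// !mulr_ge0// ltW.
  have fl' : f l' = f l.
    have /eqP := Hf l; rewrite -oppr_eq0 -sumrN psumr_eq0; last first.
      by move=> a _; rewrite -mulrN mulr_ge0// opprB subr_ge0.
    move=> /allP/(_ l'); rewrite mem_index_enum => /(_ isT)/=.
    by rewrite oppr_eq0 mulf_eq0 gt_eqF//= subr_eq0 => /eqP.
  have [||z z1 z2] := IH l'.
  - by have := incr_qtotal up; rewrite lk => -[].
  - by move=> a; rewrite fl'.
  - by exists z => //; rewrite z2.
have zE (z z' : state n m) : qtotal z = 0%N -> qtotal z' = 0%N -> z = z'.
  move=> /eqP; rewrite sum_nat_eq0 => /forallP a.
  move=> /eqP; rewrite sum_nat_eq0 => /forallP b.
  apply: val_inj; apply/ffunP => j; apply: val_inj => /=.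
  by move: (a j) (b j) => /= /eqP aj /eqP bj; rewrite [LHS]aj [RHS]bj.
pose lM := [arg max_(l > z0) h l]%O.
pose lm := [arg max_(l > z0) - h l]%O.
have hM l : h l <= h lM by rewrite /lM; case: arg_maxP => // i _; exact.
have hm l : - h l <= - h lm by rewrite /lm; case: arg_maxP => // i _; exact.
have [z zt zM] := down _ h lM erefl harm hM.
have [|z' zt' zm] := down _ (fun l => - h l) lm erefl _ hm.
  move=> l; apply: oppr_inj; rewrite oppr0 -[RHS](harm l) -sumrN.
  apply: eq_bigr => l' _.
  by rewrite -mulrN opprD !opprK.
have {zt zt'}E := zE _ _ zt zt'; move: zm; rewrite -E => /oppr_inj zm.
have hc l : h l = h z.
  apply/le_anti/andP; split; [by rewrite zM | by rewrite zm -lerN2].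
have : h z * \sum_l w l = 1.
  by rewrite -nu1 mulr_sumr; apply: eq_bigr => l _; rewrite nuE hc.
move=> hW l; rewrite nuE hc /stationary_pmf -/(w _); congr (_ * _).
by apply: (mulIf (lt0r_neq0 W0)); rewrite hW mulVf// lt0r_neq0.
Qed.

(* Lebesgue measure of a Borel set of [R^n], as an iterated integral *)
Fixpoint lebesgue_volume (R : realType) (n : nat) :
    set (n.-tuple R) -> \bar R :=
  match n return set (n.-tuple R) -> \bar R with
  | 0 => fun A => \d_([tuple] : 0.-tuple R) A
  | n'.+1 => fun A => (\int[@lebesgue_measure R]_x
      lebesgue_volume [set t : n'.-tuple R | A [tuple of x :: t]])%E
  end.

Definition unit_simplex (R : realType) n : set (n.-tuple R) :=
  [set x | (forall i, 0 <= tnth x i) /\ \sum_(i < n) `|tnth x i| = 1].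
Arguments unit_simplex R n : clear implicits.

(* The affine parametrization [t |-> (t_1, ..., t_(n-1), 1 - sum t)] of the
   hyperplane [sum x = 1]; the last coordinate is the default value of [nth]. *)
Definition simplex_chart (R : realType) n (t : n.-1.-tuple R) : n.-tuple R :=
  [tuple nth (1 - \sum_(y <- t) y) t i | i < n].

(* Surface measure on the simplex is proportional to the image by
   [simplex_chart] of the Lebesgue measure of dimension [n - 1] (a Dirac mass
   for [n = 1]). *)
Definition uniform_on_simplex (R : realType) n d (T : measurableType d)
    (P : probability T R) (X : T -> n.-tuple R) : Prop :=
  forall A : set (n.-tuple R), measurable A ->
    P (X @^-1` A) =
      (fine (lebesgue_volume (@simplex_chart R n @^-1` (A `&` unit_simplex R n)))
       / fine (lebesgue_volume (@simplex_chart R n @^-1` unit_simplex R n)))%:E.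

Definition cvg_in_distribution (R : realType) n (d : nat -> measure_display)
    (T : forall m, measurableType (d m)) (P : forall m, probability (T m) R)
    (Y : forall m, T m -> 'rV[R]_n) d' (S : measurableType d')
    (Q : probability S R) (Z : S -> 'rV[R]_n) : Prop :=
  forall f : 'rV[R]_n -> R, continuous f ->
    (exists M : R, forall x, `|f x| <= M) ->
    ('E_(P m)[f \o @Y m] @[m --> \oo] --> 'E_Q[f \o Z])%E.

Definition rV_of_tuple (R : realType) n (x : n.-tuple R) : 'rV[R]_n :=
  \row_i tnth x i.

Definition qlen_rV (R : realType) n m (l : state n m) : 'rV[R]_n :=
  \row_i (qlen l i)%:R.

(* The default value 0 is harmless on vectors with nonnegative entries. *)
Definition tuple_max (R : realType) n (x : n.-tuple R) : R :=
  \big[Num.max/0]_(i < n) tnth x i.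

Definition Hsum (R : realType) (k n : nat) : R := \sum_(1 <= i < n.+1) i%:R ^- k.

(* Main.v *)
(* Substituting l = a + l' in the sum of the stationary weights over the orthant
   l >= a shows that P(L >= a) depends only on |a|: it is the ratio of the means
   of 'C(m - |a| - j + n - 1, n - 1) and of 'C(m - j + n - 1, n - 1) when j has
   the Poisson law of parameter kappa truncated at m.  By Chebyshev's inequality
   j is close to kappa, so that P(L_i >= a_i (m - kappa) for all i) tends to
   (1 - sum a)_+^(n-1), which is also the survival function of the uniform law
   on the simplex.  By inclusion-exclusion the probabilities of rectangular cells
   converge too, and a continuous function is uniformly close, on a cube, to a
   function that is constant on the cells of a fine grid.  Inclusion-exclusion
   also gives P(max X < r) = sum_k (-1)^k 'C(n, k) (1 - k r)_+^(n-1); the moments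
   of max X follow by integrating the tail, and the Gumbel limit by dominated
   convergence of this sum. *)

Require Import Defs.
From HB Require Import structures.
From mathcomp Require Import all_boot all_order all_algebra.
From mathcomp Require Import all_classical all_reals all_analysis.
From mathcomp Require Import measurable_realfun.
From mathcomp Require Import ring lra.

Set Implicit Arguments.
Unset Strict Implicit.
Unset Printing Implicit Defensive.

Import Order.TTheory GRing.Theory Num.Theory.
Import numFieldNormedType.Exports.

Local Open Scope classical_set_scope.
Local Open Scope ring_scope.

(** * Truncated Poisson averages *)

(** From here on [n = p.+1], so that the exponent [n - 1] is [p]. Orthants are good test sets
    because the stationary weight depends on a state only through its total: given the total, the
    queue vector is uniform on a lattice simplex, and the survival function is explicit both before
    and after the limit. The obstacle is [p = 0], where the limit law is the Dirac mass at 1: the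
    survival function jumps where the thresholds add up to 1, so convergence of orthant
    probabilities and of distribution functions has to avoid that value, and strict and large
    inequalities must be told apart. Boundedness stands in for tightness and uniform integrability:
    a scaled queue length is at most [m / (m - kappa)], which tends to [1 / (1 - kbar)], so powers
    clipped to a fixed interval are admissible test functions and moments converge too. Distribution
    functions are recovered by squeezing indicators between continuous ramps. *)

Definition poisson_weight (R : realType) (k : R) (j : nat) : R := k ^+ j / j`!%:R.

Lemma poisson_weight_gt0 (R : realType) (k : R) j : 0 < k -> 0 < poisson_weight k j.
Proof. by move=> k0; rewrite divr_gt0 ?exprn_gt0// ltr0n fact_gt0. Qed.

(* Unlike for the full Poisson law, the truncated second moment about [k] is not
   exactly [k] times the mass, but the defect has a closed form. *)
Lemma sum_poisson_weight_dev (R : realType) (k : R) m :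
  \sum_(j < m.+1) poisson_weight k j * ((j%:R - k) ^+ 2 - k)
  = poisson_weight k m * (k * (k - m.+1%:R)).
Proof.
elim: m => [|m IH].
  by rewrite big_ord1 /poisson_weight expr0 /=; ring.
rewrite big_ord_recr/= IH.
have -> : poisson_weight k m * (k * (k - m.+1%:R)) =
    poisson_weight k m.+1 * (m.+1%:R * (k - m.+1%:R)).
  rewrite /poisson_weight factS natrM exprS.
  have f0 : m`!%:R != 0 :> R by rewrite pnatr_eq0 -lt0n fact_gt0.
  have s0 : m.+1%:R != 0 :> R by rewrite pnatr_eq0.
  by field; rewrite f0 nat1r s0.
by rewrite -mulrDr; congr (_ * _); ring.
Qed.

(** Chebyshev's inequality, averaged against the weights: where [j] is farther than [e] from [k],
    the crude bound [C] is at most [C * (j - k)^2 / e^2]. Since [k <= m.+1], the defect in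
    [sum_poisson_weight_dev] is nonpositive, so the truncated second moment about [k] is at most [k]
    times the mass. *)
Lemma poisson_mean_dist (R : realType) (k : R) m (g : nat -> R) (c C eta e : R) :
  0 < k -> k <= m.+1%:R -> 0 < e -> 0 <= eta ->
  (forall j, (j <= m)%N -> `|g j - c| <= C) ->
  (forall j, (j <= m)%N -> `|j%:R - k| <= e -> `|g j - c| <= eta) ->
  `|(\sum_(j < m.+1) poisson_weight k j * g j) / (\sum_(j < m.+1) poisson_weight k j)
    - c| <= eta + C * k / e ^+ 2.
Proof.
move=> k0 km e0 eta0 gC geta.
set W := \sum_(j < m.+1) poisson_weight k j.
have W0 : 0 < W.
  rewrite /W big_ord_recl ltr_pwDl ?poisson_weight_gt0// sumr_ge0// => i _.
  exact/ltW/poisson_weight_gt0.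
have C0 : 0 <= C by apply: le_trans (gC 0%N _).
have e20 : 0 < e ^+ 2 by rewrite exprn_gt0.
have gE j : (j <= m)%N -> `|g j - c| <= eta + C * (j%:R - k) ^+ 2 / e ^+ 2.
  move=> jm; have [je|je] := leP `|j%:R - k| e.
    apply: le_trans (geta _ jm je) _; rewrite lerDl.
    by apply: divr_ge0; [exact: mulr_ge0 C0 (sqr_ge0 _) | exact: ltW].
  apply: le_trans (gC _ jm) _; apply: ler_wpDl => //.
  rewrite ler_pdivlMr// ler_wpM2l// -[leRHS]real_normK ?num_real//.
  by rewrite ler_sqr ?nnegrE// ltW.
have dev : \sum_(j < m.+1) poisson_weight k j * (j%:R - k) ^+ 2 <= k * W.
  rewrite -subr_le0 /W mulr_sumr -sumrB.
  under eq_bigr do rewrite [k * _]mulrC -mulrBr.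
  rewrite sum_poisson_weight_dev pmulr_rle0 ?poisson_weight_gt0//.
  by rewrite pmulr_rle0// subr_le0.
have -> : (\sum_(j < m.+1) poisson_weight k j * g j) / W - c =
    (\sum_(j < m.+1) poisson_weight k j * (g j - c)) / W.
  under [in RHS]eq_bigr do rewrite mulrBr.
  by rewrite sumrB -mulr_suml -/W; field; rewrite lt0r_neq0.
rewrite normrM normfV (gtr0_norm W0) ler_pdivrMr//.
apply: le_trans (ler_norm_sum _ _ _) _.
apply: (@le_trans _ _ (\sum_(j < m.+1) poisson_weight k j *
    (eta + C * (j%:R - k) ^+ 2 / e ^+ 2))).
  apply: ler_sum => j _; rewrite normrM gtr0_norm ?poisson_weight_gt0//.
  by rewrite ler_pM2l ?poisson_weight_gt0// gE// -ltnS.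
under eq_bigr do rewrite mulrDr.
rewrite big_split/= -mulr_suml -/W mulrDl [W * _]mulrC lerD2l.
have -> : \sum_(j < m.+1) poisson_weight k j * (C * (j%:R - k) ^+ 2 / e ^+ 2) =
   (C / e ^+ 2) * \sum_(j < m.+1) poisson_weight k j * (j%:R - k) ^+ 2.
  by rewrite mulr_sumr; apply: eq_bigr => j _; ring.
have -> : C * k / e ^+ 2 * W = C / e ^+ 2 * (k * W) by ring.
by rewrite ler_wpM2l// divr_ge0// ltW.
Qed.

Lemma ffact_le_expn q p : (q ^_ p <= q ^ p)%N.
Proof.
elim: p q => [//|p IH] q; rewrite ffactnS expnS leq_mul//.
by apply: leq_trans (IH _) _; case: p {IH} => [//|p]; rewrite leq_exp2r// leq_pred.
Qed.

(** The quantity between the two powers is the product (u + 1) ... (u + p). *)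
Lemma bin_scaled_bounds (R : realType) (u p : nat) :
  (u%:R : R) ^+ p <= 'C(u + p, p)%:R * p`!%:R :> R /\
  'C(u + p, p)%:R * p`!%:R <= (u%:R + p%:R) ^+ p :> R.
Proof.
have lo : (u ^ p <= (u + p) ^_ p)%N.
  elim: p => [//|p IH]; rewrite addnS ffactSS expnS leq_mul//.
  by rewrite ltnW// ltnS leq_addr.
have := conj lo (ffact_le_expn (u + p) p) => -[].
by rewrite -!(ler_nat R) !natrX natrD -bin_ffact natrM => ? ?; split.
Qed.

(* With [p = 0] these are the indicators of [0, +oo[ and of ]0, +oo[: when n = 1
   the law of X has an atom, and the two conventions differ at [x = 0]. *)
Definition pospow (R : realType) (p : nat) (x : R) : R := if 0 <= x then x ^+ p else 0.

Definition pospow_strict (R : realType) (p : nat) (x : R) : R := if 0 < x then x ^+ p else 0.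

Lemma pospow_ge0 (R : realType) p (x : R) : 0 <= pospow p x.
Proof. by rewrite /pospow; case: ifP => // x0; rewrite exprn_ge0. Qed.

Lemma cvg_natr_invr (R : realType) : (m%:R^-1 : R) @[m --> \oo] --> (0 : R).
Proof.
apply/cvgrPdist_le => e e0; near=> m.
have m0 : (0 < m)%N by near: m; exists 1%N.
rewrite sub0r normrN ger0_norm ?invr_ge0// invf_ple ?posrE ?ltr0n//.
by near: m; exact: nbhs_infty_ger.
Unshelve. all: by end_near. Qed.

(** The binomial coefficient counts the states above thresholds of sum [a] that leave [j] customers
    at the infinite-server node; the factor [p! / m^p] turns it, asymptotically, into the [p]-th
    power of a proportion of the customers. *)
Definition binomial_tail (R : realType) (p m a j : nat) : R :=
  if (a + j <= m)%N then 'C(m - a - j + p, p)%:R * p`!%:R / m%:R ^+ p else 0.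

(** The mean concentrates at [j] close to [kappa], where the tail is close to
    [(1 - a / m - kappa / m)^p]. The argument of the limit must be nonzero because [pospow 0] jumps
    at 0. *)
Lemma poisson_mean_binomial_tail_cvg (R : realType) (kappa : nat -> R) (kbar alpha : R)
    (a : nat -> nat) (p : nat) :
  (forall m, 0 < kappa m) -> kappa m / m%:R @[m --> \oo] --> kbar -> kbar < 1 ->
  (a m)%:R / m%:R @[m --> \oo] --> alpha -> 1 - kbar - alpha != 0 ->
  (\sum_(j < m.+1) poisson_weight (kappa m) j * binomial_tail R p m (a m) j) /
    (\sum_(j < m.+1) poisson_weight (kappa m) j) @[m --> \oo]
  --> pospow p (1 - kbar - alpha).
Proof.
move=> k0 kcvg kbar1 acvg; set x := 1 - kbar - alpha => x0.
(* Error budget: [kappa / m], [a / m] and [j / m] each contribute a deviation of at most [e], and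
   [p / m] a fourth one. The inequality [5 e <= |x|] preserves the sign of [x] under these
   deviations. *)
have dP : forall eta, 0 < eta -> exists2 e, 0 < e & (e * 5 <= `|x|) /\
    forall v, `|v - x| <= e * 4 -> `|v ^+ p - x ^+ p| <= eta.
  move=> eta eta0.
  have : (v ^+ p : R) @[v --> x] --> x ^+ p by exact: exprn_continuous.
  move=> /cvgrPdist_le/(_ _ eta0)/nbhs_ballP[d' /= d'0 d'P].
  have m0 : 0 < Num.min d' `|x| by rewrite lt_min d'0 normr_gt0.
  exists (Num.min d' `|x| / 5); first by rewrite divr_gt0.
  split; first by rewrite divfK// ge_min lexx orbT.
  move=> v vx; rewrite distrC; apply: d'P; rewrite /ball/= distrC.
  apply: le_lt_trans vx _; have : Num.min d' `|x| <= d' by rewrite ge_min lexx.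
  lra.
apply/cvgrPdist_le => eta eta0.
have eta20 : 0 < eta / 2 by rewrite divr_gt0.
have [e e0 [ex eP]] := dP _ eta20.
set c := pospow p x.
pose C := (1 + p%:R) ^+ p + c.
near=> m.
have m0 : (0 < m)%N by near: m; exists 1%N.
have mR0 : 0 < m%:R :> R by rewrite ltr0n.
have km1 : kappa m / m%:R < 1.
  by near: m; apply: cvgr_lt kbar1; exact: kcvg.
have kme : `|kappa m / m%:R - kbar| <= e.
  by rewrite distrC; near: m; move/cvgrPdist_le : kcvg; exact.
have ame : `|(a m)%:R / m%:R - alpha| <= e.
  by rewrite distrC; near: m; move/cvgrPdist_le : acvg; exact.
have pme : p%:R / m%:R <= e.
  rewrite ler_pdivrMr// -ler_pdivrMl//; near: m; exact: nbhs_infty_ger.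
have Cme : C / e ^+ 2 / m%:R <= eta / 2.
  rewrite ler_pdivrMr// -ler_pdivrMl//; near: m; exact: nbhs_infty_ger.
have km : kappa m <= m%:R by move: km1; rewrite ltr_pdivrMr// mul1r => /ltW.
have c0 : 0 <= c by exact: pospow_ge0.
have hb j : 0 <= binomial_tail R p m (a m) j <= (1 + p%:R) ^+ p.
  rewrite /binomial_tail; case: ifPn => [aj|_]; last by rewrite lexx/= exprn_ge0// addr_ge0.
  rewrite divr_ge0 ?mulr_ge0 ?exprn_ge0//= ler_pdivrMr ?exprn_gt0//.
  have [_ h] := bin_scaled_bounds R (m - a m - j) p.
  apply: le_trans h _; rewrite -exprMn lerXn2r ?nnegrE ?mulr_ge0 ?addr_ge0//.
  rewrite mulrDl mul1r lerD// ?ler_nat; first by rewrite -subnDA leq_subr.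
  by rewrite ler_peMr// ler1n.
rewrite distrC.
apply: (@le_trans _ _ (eta / 2 + C * kappa m / (e * m%:R) ^+ 2)); last first.
  rewrite [leRHS](splitr eta) lerD2l; apply: le_trans Cme.
  have -> : C / e ^+ 2 / m%:R = C * m%:R / (e * m%:R) ^+ 2.
    by field; rewrite lt0r_neq0//= lt0r_neq0.
  rewrite ler_pM2r ?invr_gt0 ?exprn_gt0 ?mulr_gt0// ler_wpM2l//.
  by rewrite addr_ge0// exprn_ge0// addr_ge0.
apply: poisson_mean_dist => //.
- by apply: le_trans km _; rewrite ler_nat.
- exact: mulr_gt0.
- exact: ltW.
- move=> j jm; have /andP[h0 h1] := hb j.
  apply: le_trans (ler_normB _ _) _.
  by rewrite ger0_norm// (ger0_norm c0) lerD2r.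
move=> j jm jk.
have jke : `|j%:R / m%:R - kappa m / m%:R| <= e.
  by rewrite -mulrBl normrM normfV (gtr0_norm mR0) ler_pdivrMr.
pose v : R := 1 - (a m)%:R / m%:R - j%:R / m%:R.
have xj : `|v - x| <= e * 3.
  move: jke ame kme; rewrite !ler_norml /x /v; lra.
rewrite /binomial_tail; case: ifPn => [aj|aj].
  have vE : (m - a m - j)%:R / m%:R = v.
    rewrite /v -subnDA natrB// natrD; field; exact: lt0r_neq0.
  have v0 : 0 <= v by rewrite -vE divr_ge0.
  have x0' : 0 < x.
    rewrite lt_neqAle eq_sym x0 /= leNgt; apply/negP => xn.
    by move: ex xj; rewrite ltr0_norm// ler_norml; lra.
  rewrite /c /pospow (ltW x0').
  have [h1 h2] := bin_scaled_bounds R (m - a m - j) p.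
  have := eP _ (le_trans xj _); have -> : e * 3 <= e * 4 by rewrite ler_pM2l// ler_nat.
  move=> /(_ isT); rewrite !ler_norml.
  have := eP (v + p%:R / m%:R).
  have -> : `|v + p%:R / m%:R - x| <= e * 4.
    have : 0 <= p%:R / m%:R :> R by rewrite divr_ge0.
    move: xj pme; rewrite !ler_norml; lra.
  move=> /(_ isT); rewrite ler_norml.
  have {h1} : v ^+ p <=
    'C(m - a m - j + p, p)%:R * p`!%:R / m%:R ^+ p.
    by rewrite -vE expr_div_n ler_pM2r// invr_gt0 exprn_gt0.
  have {h2} : 'C(m - a m - j + p, p)%:R * p`!%:R / m%:R ^+ p <=
     (v + p%:R / m%:R) ^+ p.
    by rewrite -vE -mulrDl expr_div_n ler_pM2r// invr_gt0 exprn_gt0.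
  lra.
(* Here [a m + j > m], that is [v < 0], so a positive [x] would lie at distance more than [5 e] from
   [v]. *)
have [xp|xn] := leP 0 x; last first.
  by rewrite /c /pospow (lt_geF xn) subrr normr0 ltW.
have xp' : 0 < x by rewrite lt_neqAle eq_sym x0.
exfalso; move/negP : aj; apply.
rewrite -(ler_nat R) natrD -[leRHS]mul1r -ler_pdivrMr// mulrDl.
by move: ex xj; rewrite gtr0_norm// ler_norml /v; lra.
Unshelve. all: by end_near. Qed.

(** * Survival function of the queue lengths *)

(** Stars and bars after the shift [l = a + t]. The condition [s <= m] ensures that the bounded
    codomain ['I_m.+1] excludes no vector of sum [s]. *)
Lemma card_ffun_sum_ge (p m s : nat) (a : 'I_p.+1 -> nat) :
  (\sum_i a i <= s)%N -> (s <= m)%N ->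
  #|[set l : {ffun 'I_p.+1 -> 'I_m.+1} |
      [forall i, (a i <= l i)%N] && (\sum_i l i == s)%N]%SET|
  = 'C(s - \sum_i a i + p, p).
Proof.
move=> als sm; set r := (s - _)%N.
rewrite addnC -card_ord_partitions.
pose f (t : p.+1.-tuple 'I_r.+1) : {ffun 'I_p.+1 -> 'I_m.+1} :=
  [ffun i => inord (a i + tnth t i)].
have le_sum (F : 'I_p.+1 -> nat) i : (F i <= \sum_j F j)%N.
  by rewrite (bigD1 i)//= leq_addr.
have fE (t : p.+1.-tuple 'I_r.+1) i :
    (\sum_(i <- t) i == r)%N -> f t i = (a i + tnth t i)%N :> nat.
  rewrite big_tuple => /eqP tr; rewrite ffunE inordK// ltnS (leq_trans _ sm)//.
  rewrite -(subnKC als) leq_add ?le_sum// -/r -[leqRHS]tr.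
  exact: (le_sum (fun i => tnth t i : nat)).
rewrite -(@card_in_imset _ _ f); last first.
  move=> t u; rewrite !inE => ht hu ftu; apply: eq_from_tnth => i.
  apply: val_inj; apply: (@addnI (a i)) => /=.
  by rewrite -!fE// ftu.
apply: eq_card => l; rewrite inE.
apply/idP/imsetP => [/andP[/forallP al /eqP ls]|[t]].
  have sumE : (\sum_i (l i - a i) = r)%N.
    by rewrite sumnB// ls.
  have lE i : (inord (l i - a i) : 'I_r.+1) = (l i - a i)%N :> nat.
    by rewrite inordK// ltnS -sumE (le_sum (fun i => l i - a i)%N).
  pose t : p.+1.-tuple 'I_r.+1 := [tuple inord (l i - a i) | i < p.+1].
  have tr : (\sum_(i <- t) i == r)%N.
    rewrite big_tuple; apply/eqP; rewrite -[RHS]sumE; apply: eq_bigr => i _.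
    by rewrite tnth_mktuple lE.
  exists t; first by rewrite inE.
  apply/ffunP => i; apply: val_inj => /=.
  by rewrite fE// tnth_mktuple lE subnKC.
rewrite inE => tr ->; apply/andP; split.
  by apply/forallP => i; rewrite fE// leq_addr.
under eq_bigr do rewrite fE//.
rewrite big_split/=; move: tr; rewrite big_tuple => /eqP ->.
by rewrite /r subnKC.
Qed.

Definition states_ge (n m : nat) (a : 'I_n -> nat) : pred (state n m) :=
  fun l => [forall i, (a i <= qlen l i)%N].

Lemma sum_states_ge (R : realType) (p m : nat) (a : 'I_p.+1 -> nat) (F : nat -> R) :
  \sum_(l : state p.+1 m | states_ge a l) F (qtotal l)
  = \sum_(s < m.+1 | (\sum_i a i <= s)%N) 'C(s - \sum_i a i + p, p)%:R * F s.
Proof.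
rewrite (partition_big (fun l : state p.+1 m => Ordinal (qtotal_le l : (_ < m.+1)%N))
  (fun s => (\sum_i a i <= s)%N))/=; last first.
  by move=> l /forallP al; exact: leq_sum.
apply: eq_bigr => s als.
rewrite (eq_bigr (fun=> F s)); last by move=> l /andP[_ /eqP <-].
rewrite sumr_const -[LHS]mulr_natl -(card_ffun_sum_ge als (leq_ord s)).
congr (_%:R * _).
rewrite -(card_in_imset (f := val)); last by move=> ? ? _ _; exact: val_inj.
apply: eq_card => l; rewrite [RHS]inE.
apply/imsetP/idP => [[l' hl' ->]|/andP[al /eqP ls]].
  have /andP[al /eqP <-] : states_ge a l' && (Ordinal (qtotal_le l' : (_ < m.+1)%N) == s) by [].
  by rewrite [X in X && _]al /= eqxx.
have lm : (\sum_(i < p.+1) l i <= m)%N by rewrite ls -ltnS.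
exists (exist _ l lm) => //; apply/andP; split; first exact: al.
exact/eqP/val_inj.
Qed.

(** Reversing the summation index, [j = m - s] is the number of customers at the infinite-server
    node and [kappa^-s / (m - s)!] is [kappa^-m] times the Poisson weight of [j]. The prefactor does
    not involve [a], hence cancels in probabilities. *)
Lemma sum_stationary_weight_ge (R : realType) (p m : nat) (kappa : R)
    (a : 'I_p.+1 -> nat) : 0 < kappa -> (0 < m)%N ->
  \sum_(l : state p.+1 m | states_ge a l) stationary_weight kappa l
  = m`!%:R * kappa ^- m * m%:R ^+ p / p`!%:R *
    \sum_(j < m.+1) poisson_weight kappa j * binomial_tail R p m (\sum_i a i)%N j.
Proof.
move=> k0 m0.
rewrite (sum_states_ge m a (fun s => m`!%:R * kappa ^- s / (m - s)`!%:R)).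
rewrite big_mkcond (reindex_inj rev_ord_inj)/= mulr_sumr; apply: eq_bigr => j _.
have jm : (j <= m)%N by rewrite -ltnS.
rewrite subSS subKn// /binomial_tail leq_subRL// [(_ + j)%N]addnC -leq_subRL// leq_subRL// addnC.
case: ifP => _; last by rewrite !mulr0.
rewrite /poisson_weight [(m - _ - j)%N]subnAC.
have pf : p`!%:R != 0 :> R by rewrite pnatr_eq0 -lt0n fact_gt0.
have jf : j`!%:R != 0 :> R by rewrite pnatr_eq0 -lt0n fact_gt0.
have mp : m%:R ^+ p != 0 :> R by rewrite expf_neq0// pnatr_eq0 -lt0n.
have kn i : kappa ^+ i != 0 by rewrite expf_neq0// lt0r_neq0.
have kE : kappa ^- (m - j) = kappa ^- m * kappa ^+ j.
  by rewrite -[in kappa ^- m](subnK jm) exprD; field; rewrite !kn.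
rewrite kE.
by field; rewrite pf jf mp kn.
Qed.

Lemma cvg_sumr (R : realType) (I : finType) (T : Type) (F : set_system T) (f : I -> T -> R)
    (a : I -> R) : Filter F -> (forall i, f i x @[x --> F] --> a i) ->
  \sum_i f i x @[x --> F] --> \sum_i a i.
Proof. by move=> FF fa; apply: cvg_big => //; exact: add_continuous. Qed.

Section finite_valued.
Context (R : realType) d (T : measurableType d) (P : probability T R) (S : finType)
  (L : T -> S).
Hypothesis mL : forall l, measurable (L @^-1` [set l]).

Lemma measurable_finite_preimage (B : set S) : measurable (L @^-1` B).
Proof.
rewrite (_ : _ @^-1` _ = \bigcup_(l in B) (L @^-1` [set l])).
  by apply: fin_bigcup_measurable => // l _; exact: mL.
by apply/seteqP; split=> [w Bw|w [l Bl /= ->]//]; exists (L w).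
Qed.

Lemma probability_finite_preimage (B : pred S) :
  P (L @^-1` [set l | B l]) = (\sum_(l | B l) fine (P (L @^-1` [set l])))%:E.
Proof.
rewrite (_ : _ @^-1` _ = \bigcup_(l in [set` B]) (L @^-1` [set l])); last first.
  by apply/seteqP; split=> [w Bw|w [l Bl /= ->]//]; exists (L w).
rewrite measure_fin_bigcup//; last by move=> i j _ _ [w [/= -> ->]].
rewrite -sumEFin [RHS]bigfs ?index_enum_uniq//; last by move=> i _; rewrite mem_index_enum.
by apply: eq_fsbigr => l _; rewrite fineK// fin_num_measure.
Qed.
End finite_valued.

Section queue_survival.
Context (R : realType) (p : nat) (kappa : nat -> R) (kbar : R).
Hypothesis kappa_gt0 : forall m, 0 < kappa m.
Hypothesis kappa_cvg : kappa m / m%:R @[m --> \oo] --> kbar.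
Hypothesis kbar_lt1 : kbar < 1.

Lemma cvg_scaled_gap : (m%:R - kappa m) / m%:R @[m --> \oo] --> 1 - kbar.
Proof.
have : 1 - kappa m / m%:R @[m --> \oo] --> 1 - kbar by apply: cvgB => //; exact: cvg_cst.
apply: cvg_trans; apply: near_eq_cvg; near=> m.
rewrite mulrBl divff// pnatr_eq0 -lt0n.
by near: m; exists 1%N.
Unshelve. all: by end_near. Qed.

Lemma near_gap_gt0 : \forall m \near \oo, kappa m < m%:R.
Proof.
near=> m.
have m0 : (0 < m)%N by near: m; exists 1%N.
rewrite -[ltRHS]mul1r -ltr_pdivrMr ?ltr0n//.
by near: m; apply: cvgr_lt kbar_lt1; exact: kappa_cvg.
Unshelve. all: by end_near. Qed.

Context (d : nat -> measure_display) (T : forall m, measurableType (d m))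
  (P : forall m, probability (T m) R) (L : forall m, T m -> state p.+1 m).
Hypothesis mL : forall m l, measurable (@L m @^-1` [set l]).
Hypothesis pmfL : forall m l,
  fine (P m (@L m @^-1` [set l])) = stationary_pmf (kappa m) l.

Lemma queue_tailE m (a : 'I_p.+1 -> nat) : (0 < m)%N ->
  let M b := (\sum_(j < m.+1) poisson_weight (kappa m) j * binomial_tail R p m b j) /
             (\sum_(j < m.+1) poisson_weight (kappa m) j) in
  P m [set w | states_ge a (@L m w)] = (M (\sum_i a i)%N / M 0%N)%:E.
Proof.
move=> m0 M.
have := probability_finite_preimage (P m) (@mL m) (states_ge a).
rewrite [X in P m X](_ : _ = [set w | states_ge a (@L m w)])// => ->.
congr EFin; rewrite (eq_bigr (fun l => stationary_pmf (kappa m) l)); last first.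
  by move=> l _; exact: pmfL.
rewrite /stationary_pmf.
rewrite -mulr_sumr sum_stationary_weight_ge//.
have -> : \sum_(l : state p.+1 m) stationary_weight (kappa m) l =
   \sum_(l : state p.+1 m | states_ge (fun=> 0%N) l) stationary_weight (kappa m) l.
  by rewrite [RHS]big_mkcond; apply: eq_bigr => l _; rewrite ifT//; apply/forallP.
rewrite sum_stationary_weight_ge// [(\sum_(_ < _) 0)%N]big1// /M.
set W := \sum_(j < _) poisson_weight _ _.
set N0 := \sum_(j < _) _; set N := \sum_(j < _) _; set c := _ / p`!%:R.
have W0 : W != 0.
  rewrite lt0r_neq0// /W big_ord_recl ltr_pwDl ?poisson_weight_gt0// sumr_ge0// => i _.
  exact/ltW/poisson_weight_gt0.
have c0 : c != 0.
  by rewrite lt0r_neq0// /c divr_gt0 ?mulr_gt0 ?invr_gt0 ?exprn_gt0 ?ltr0n ?fact_gt0.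
(* With the convention that the inverse of 0 is 0, both sides vanish in this degenerate case;
   otherwise [field] applies. *)
have [->|N00] := eqVneq N0 0; first by rewrite mulr0 invr0 !mul0r invr0 mulr0.
by field; rewrite W0 c0 N00.
Qed.

(** Queue lengths are integers, so each real threshold is rounded up to [A m i], which moves its
    ratio to [m] by at most [1 / m]. The limit is a quotient in which the factor [(1 - kbar)^p]
    cancels by homogeneity; [\sum_i a i != 1] keeps the argument of its numerator off 0. *)
Lemma queue_survival_cvg (a : 'I_p.+1 -> R) :
  (forall i, 0 <= a i) -> \sum_i a i != 1 ->
  P m [set w | forall i, a i <= (m%:R - kappa m)^-1 * (qlen (@L m w) i)%:R] @[m --> \oo]
  --> (pospow p (1 - \sum_i a i))%:E.
Proof.
move=> a0 a1.
pose A m i := `|Num.ceil (a i * (m%:R - kappa m))|%N.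
pose M m b := (\sum_(j < m.+1) poisson_weight (kappa m) j * binomial_tail R p m b j) /
             (\sum_(j < m.+1) poisson_weight (kappa m) j).
have kb0 : 0 < 1 - kbar by rewrite subr_gt0.
suff : (M m (\sum_i A m i)%N / M m 0%N)%:E @[m --> \oo] --> (pospow p (1 - \sum_i a i))%:E.
  apply: cvg_trans; apply: near_eq_cvg; near=> m.
  have m0 : (0 < m)%N by near: m; exists 1%N.
  have km : kappa m < m%:R by near: m; exact: near_gap_gt0.
  have D0 : 0 < m%:R - kappa m by rewrite subr_gt0.
  rewrite -queue_tailE//; congr (P m _); apply/seteqP.
  have eqA l i : (A m i <= qlen l i)%N = (a i <= (m%:R - kappa m)^-1 * (qlen l i)%:R).
    rewrite ler_pdivlMl// [X in X <= _]mulrC -lez_nat /A gez0_abs; last first.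
      by rewrite ceil_ge0 (lt_le_trans (ltrN10 _))// mulr_ge0// ltW.
    by rewrite ceil_le_int.
  split=> w /=; first by move=> /forallP h i; rewrite -eqA.
  by move=> h; apply/forallP => i; rewrite eqA.
apply: cvg_EFin; first exact: nearW.
have scale0 : 1 - kbar - 0 != 0 by rewrite subr0 lt0r_neq0.
have Acvg : (\sum_i A m i)%N%:R / m%:R @[m --> \oo] --> (\sum_i a i) * (1 - kbar).
  rewrite mulr_suml; under eq_cvg do rewrite natr_sum mulr_suml.
  apply: cvg_sumr => i.
  have h1 : a i * ((m%:R - kappa m) / m%:R) @[m --> \oo] --> a i * (1 - kbar).
    by apply: cvgM; [exact: cvg_cst|exact: cvg_scaled_gap].
  have h2 : a i * ((m%:R - kappa m) / m%:R) + m%:R^-1 @[m --> \oo] --> a i * (1 - kbar).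
    by rewrite -[X in _ --> X]addr0; apply: cvgD => //; exact: cvg_natr_invr.
  apply: squeeze_cvgr h1 h2; near=> m.
  have km : kappa m < m%:R by near: m; exact: near_gap_gt0.
  have D0 : 0 < m%:R - kappa m by rewrite subr_gt0.
  have AE : (A m i)%:R = (Num.ceil (a i * (m%:R - kappa m)))%:~R :> R.
    by rewrite /A natr_absz ger0_norm// ceil_ge0 (lt_le_trans (ltrN10 _))// mulr_ge0// ltW.
  have -> : a i * ((m%:R - kappa m) / m%:R) + m%:R^-1 = (a i * (m%:R - kappa m) + 1) / m%:R.
    by ring.
  rewrite mulrA !ler_wpM2r ?invr_ge0// AE ?ceil_ge//.
  by have := ceilB1_lt (a i * (m%:R - kappa m)); rewrite intrB ltrBlDr => /ltW.
have -> : pospow p (1 - \sum_i a i) =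
    pospow p (1 - kbar - (\sum_i a i) * (1 - kbar)) / pospow p (1 - kbar - 0).
  have -> : 1 - kbar - (\sum_i a i) * (1 - kbar) = (1 - \sum_i a i) * (1 - kbar) by ring.
  rewrite subr0 /pospow (ltW kb0) pmulr_lge0//.
  case: ifP => _; last by rewrite mul0r.
  by rewrite exprMn mulfK// expf_neq0// lt0r_neq0.
apply: cvgM.
  apply: poisson_mean_binomial_tail_cvg => //.
  have -> : 1 - kbar - (\sum_i a i) * (1 - kbar) = (1 - \sum_i a i) * (1 - kbar) by ring.
  by rewrite mulf_neq0 ?(lt0r_neq0 kb0)// subr_eq0 eq_sym.
apply: cvgV; first by rewrite /pospow subr0 (ltW kb0) expf_neq0// lt0r_neq0.
apply: (@poisson_mean_binomial_tail_cvg _ kappa kbar 0 (fun=> 0%N)) => //.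
by under eq_cvg do rewrite mul0r; exact: cvg_cst.
Unshelve. all: by end_near. Qed.
End queue_survival.

(** * Survival function of the uniform law on the simplex *)

(** Differentiability is asked only inside the interval, so that antiderivatives built from the
    square root are allowed on an interval starting at 0. *)
Lemma integral_antiderivative (R : realType) (f F : R -> R) (a b : R) :
  a <= b -> continuous f -> continuous F ->
  (forall x, a < x -> x < b -> is_derive x 1 F (f x)) ->
  (\int[lebesgue_measure]_(x in `[a, b]) (f x)%:E = (F b - F a)%:E)%E.
Proof.
rewrite le_eqVlt => /predU1P[<-|ab] cf cF dF.
  by rewrite set_itv1 integral_set1 subrr.
rewrite (@continuous_FTC2 _ _ F)//; last 1 first.
- move=> x; rewrite in_itv/= => /andP[ax xb].
  by rewrite derive1E; have := dF _ ax xb => dx; rewrite derive_val.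
- exact: continuous_subspaceT.
- split.
  + by move=> x; rewrite in_itv/= => /andP[ax xb]; have [] := dF _ ax xb.
  + exact/cvg_at_right_filter/cF.
  + exact/cvg_at_left_filter/cF.
Qed.

Lemma continuous_pow_affine (R : realType) (k : nat) (b : R) :
  continuous (fun x : R => (b - x) ^+ k).
Proof.
move=> x; apply: (@continuous_comp _ _ _ (fun x => b - x) (fun y => y ^+ k)).
  by apply: cvgB; [exact: cvg_cst|exact: cvg_id].
exact: exprn_continuous.
Qed.

Lemma integral_pow_affine (R : realType) (k : nat) (a b : R) : a <= b ->
  (\int[lebesgue_measure]_(x in `[a, b]) ((b - x) ^+ k)%:E
   = ((b - a) ^+ k.+1 / k.+1%:R)%:E)%E.
Proof.
move=> ab; pose F (x : R) := - ((b - x) ^+ k.+1 / k.+1%:R).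
have dF (x : R) : is_derive x 1 F ((b - x) ^+ k).
  have h : is_derive x 1 (fun y : R => b - y) (-1).
    by apply: is_derive_eq; rewrite add0r mul1r.
  have -> : F = - k.+1%:R^-1 \*: ((fun y : R => b - y) ^+ k.+1).
    apply/funext => y; rewrite /F exprfctE.
    transitivity (- k.+1%:R^-1 * (b - y) ^+ k.+1) => //.
    by rewrite mulNr mulrC.
  apply: is_derive_eq.
  by rewrite /GRing.scale/=; field; rewrite nat1r pnatr_eq0.
rewrite (@integral_antiderivative _ _ F)//.
- by rewrite /F subrr expr0n/= mul0r oppr0 sub0r opprK.
- exact: continuous_pow_affine.
- by move=> x; apply/differentiable_continuous/derivable1_diffP; case: (dF x).
Qed.

Lemma lebesgue_volume0 (R : realType) n :
  lebesgue_volume (set0 : set (n.-tuple R)) = 0%E.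
Proof.
elim: n => [|n IH] /=; first by rewrite diracE in_set0.
apply: integral0_eq => x _; rewrite -[RHS]IH; congr lebesgue_volume.
Qed.

Definition corner (R : realType) k (a : k.-tuple R) (c : R) : set (k.-tuple R) :=
  [set t | (forall i, tnth a i <= tnth t i) /\ \sum_(y <- t) y <= c].

(** Slice along the first coordinate: for [x >= a0] the slice is a corner of one dimension less with
    bound [c - x], and otherwise it is empty. The induction step then integrates [(b - x)^k / k!]
    from [a0] to [b]. *)
Lemma lebesgue_volume_corner (R : realType) k (a : k.-tuple R) (c : R) :
  lebesgue_volume (corner a c) = (pospow k (c - \sum_(y <- a) y) / k`!%:R)%:E.
Proof.
elim: k a c => [|k IH] a c.
  rewrite /= diracE /pospow (tuple0 a) big_nil subr0 expr0 divr1.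
  case: ifPn => c0.
    by rewrite mem_set//; split; [case|rewrite big_nil].
  by rewrite memNset// /corner/= big_nil => -[_ c0']; rewrite c0' in c0.
case/tupleP: a => a0 a; rewrite big_cons /=.
have slice x : lebesgue_volume [set t : k.-tuple R | corner [tuple of a0 :: a] c [tuple of x :: t]]
   = if a0 <= x then (pospow k (c - x - \sum_(y <- a) y) / k`!%:R)%:E else 0%E.
  case: ifPn => [ax|ax].
    rewrite -IH; congr lebesgue_volume; apply/seteqP; split=> t /= [h1 h2].
      split; first by move=> i; have := h1 (lift ord0 i); rewrite !tnthS.
      by move: h2; rewrite big_cons lerBrDl.
    split; last by rewrite big_cons -lerBrDl.
    by move=> i; case: (unliftP ord0 i) => [j|] ->; rewrite ?tnthS ?tnth0.
  rewrite -(lebesgue_volume0 R k); congr lebesgue_volume.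
  apply/seteqP; split=> t //= [h1 _]; have := h1 ord0; rewrite !tnth0.
  by move/negP : ax.
under eq_integral do rewrite slice.
set b := c - \sum_(y <- a) y.
have bE x : c - x - \sum_(y <- a) y = b - x by rewrite addrAC.
have [ab|ba] := leP a0 b; last first.
  rewrite integral0_eq//; last first.
    move=> x _; case: ifPn => // ax; rewrite bE /pospow subr_ge0 ifF ?mul0r//.
    by apply/negbTE; rewrite -ltNge (lt_le_trans ba).
  rewrite /pospow ifF ?mul0r//; apply/negbTE; rewrite -ltNge subr_lt0.
  by rewrite -ltrBlDr.
transitivity (\int[lebesgue_measure]_(x in `[a0, b]) ((b - x) ^+ k / k`!%:R)%:E)%E.
  rewrite [RHS]integral_mkcond; apply: eq_integral => x _.
  rewrite patchE bE; have [ax|ax] := leP a0 x.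
    rewrite /pospow subr_ge0; have [xb|xb] := leP x b.
      by rewrite mem_set//= in_itv/= ax xb.
    by rewrite memNset ?mul0r//= in_itv/= ax/= leNgt xb.
  by rewrite memNset//= in_itv/= leNgt ax.
under eq_integral do rewrite mulrC EFinM.
rewrite ge0_integralZl//=; last 2 first.
- apply/measurable_EFinP; apply: measurable_funTS; apply: continuous_measurable_fun.
  exact: continuous_pow_affine.
- by move=> x; rewrite in_itv/= => /andP[_ xb]; rewrite lee_fin exprn_ge0// subr_ge0.
rewrite integral_pow_affine// -EFinM; congr EFin.
have -> : c - (a0 + \sum_(y <- a) y) = b - a0 by rewrite /b; ring.
rewrite /pospow subr_ge0 ab factS natrM.
by field; rewrite nat1r pnatr_eq0/= pnatr_eq0 -lt0n fact_gt0.
Qed.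

Section uniform_simplex.
Context (R : realType) (p : nat) d (S : measurableType d) (Q : probability S R)
  (X : {RV Q >-> p.+1.-tuple R}).
Hypothesis X_uniform : uniform_on_simplex Q X.

Let A (a : 'I_p.+1 -> R) : set (p.+1.-tuple R) := [set x | forall i, a i <= tnth x i].

Let mA a : measurable (A a).
Proof.
rewrite (_ : A a = \bigcap_(i in [set: 'I_p.+1]) [set x | a i <= tnth x i]); last first.
  by apply/seteqP; split=> [w h i _ /=|w h i]; [exact: h|exact: h].
apply: fin_bigcap_measurable => // i _.
have := measurable_tnth i measurableT (measurable_itv `[a i, +oo[).
rewrite setTI (_ : _ @^-1` _ = [set x | a i <= tnth x i])//.
by apply/seteqP; split=> w /=; rewrite in_itv/= andbT.
Qed.

(** The chart sends the last coordinate to [1 - sum t], so its lower bound becomes the upper bound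
    on the sum that defines a corner. As [a] is nonnegative, the lower bounds imply the sign
    conditions of [unit_simplex]. *)
Let chart_preimage a : (forall i, 0 <= a i) ->
  @simplex_chart R p.+1 @^-1` (A a `&` unit_simplex R p.+1) =
  corner [tuple a (widen_ord (leqnSn p) i) | i < p] (1 - a ord_max).
Proof.
move=> a0.
have chartw (t : p.-tuple R) (i : 'I_p) :
    tnth (@simplex_chart R p.+1 t) (widen_ord (leqnSn p) i) = tnth t i.
  by rewrite tnth_mktuple /= (tnth_nth (1 - \sum_(y <- t) y)).
have chartm (t : p.-tuple R) :
    tnth (@simplex_chart R p.+1 t) ord_max = 1 - \sum_(y <- t) y.
  by rewrite tnth_mktuple /= nth_default// size_tuple.
apply/seteqP; split=> t /= [h1 h2].
  split; first by move=> i; rewrite tnth_mktuple -chartw; exact: h1.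
  by have := h1 ord_max; rewrite chartm lerBrDl -lerBrDr.
have at' i : a i <= tnth (@simplex_chart R p.+1 t) i.
  case: (unliftP ord_max i) => [j|] ->; last by rewrite chartm lerBrDl -lerBrDr.
  have -> : lift ord_max j = widen_ord (leqnSn p) j by apply/val_inj; exact: lift_max.
  by rewrite chartw; have := h1 j; rewrite tnth_mktuple.
split=> //; split=> [i|]; first by apply: le_trans (at' i).
under eq_bigr do rewrite ger0_norm ?(le_trans (a0 _) (at' _))//.
rewrite big_ord_recr/= chartm.
under eq_bigr do rewrite chartw.
by rewrite -(big_tuple _ _ t xpredT id) addrC subrK.
Qed.

Lemma simplex_survival (a : 'I_p.+1 -> R) : (forall i, 0 <= a i) ->
  Q [set w | forall i, a i <= tnth (X w) i] = (pospow p (1 - \sum_i a i))%:E.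
Proof.
move=> a0; rewrite (X_uniform (mA a)) (chart_preimage a0).
have -> : @simplex_chart R p.+1 @^-1` unit_simplex R p.+1 =
    corner [tuple (0 : R) | i < p] (1 - 0).
  rewrite -(@chart_preimage (fun=> 0))//; congr (_ @^-1` _).
  by apply/seteqP; split=> [x xs|x []//]; split => //; case: xs.
rewrite !lebesgue_volume_corner /=; congr EFin.
have sumw (b : 'I_p -> R) : \sum_(y <- [tuple b i | i < p]) y = \sum_i b i.
  by rewrite big_tuple; apply: eq_bigr => i _; rewrite tnth_mktuple.
have sum0 : \sum_(y <- [tuple (0 : R) | i < p]) y = 0 by rewrite (sumw (fun=> 0)) big1.
rewrite sum0 sumw !subr0 [pospow p 1]/pospow ler01 expr1n.
rewrite big_ord_recr/= opprD addrA [1 - _ - _]addrAC.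
by field; rewrite pnatr_eq0 -lt0n fact_gt0.
Qed.
End uniform_simplex.

(** * Grid approximation and convergence in distribution *)

Section rectangular_cells.
Context (R : realType) (n : nat).
Implicit Types (a b : 'I_n -> R) (y : 'rV[R]_n).

Definition orthant a : set 'rV[R]_n := [set y | forall i, a i <= y 0 i].

(** As a product of differences of indicators, it turns inclusion-exclusion into the distributivity
    of products over sums. It is the indicator of a half-open box when [a <= b]. *)
Definition cell a b y : R := \prod_i ((a i <= y 0 i)%R%:R - (b i <= y 0 i)%R%:R).

Lemma orthant_prod a y : \1_(orthant a) y = \prod_i (a i <= y 0 i)%R%:R :> R.
Proof.
rewrite indicE; case: (boolP (y \in orthant a)) => [|].
  by rewrite inE => h; rewrite big1// => i _; rewrite h.
rewrite notin_setE => h; apply/esym/eqP; rewrite prodf_seq_eq0.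
have /existsNP[i ai] : ~ forall i, a i <= y 0 i by [].
apply/hasP; exists i; first by rewrite mem_index_enum.
by move/negP/negPf : ai => ->; rewrite eqxx.
Qed.

Lemma cell_expand a b y :
  cell a b y = \sum_(A : {set 'I_n})
    (-1) ^+ #|A| * \1_(orthant (fun i => if i \in A then b i else a i)) y.
Proof.
rewrite /cell; under eq_bigr do rewrite addrC.
rewrite bigA_distr; apply: eq_bigr => A _.
rewrite orthant_prod -prodr_const [X in X * _]big_mkcond -big_split/=.
by apply: eq_bigr => i _; case: ifP => _; rewrite ?mulN1r ?mul1r.
Qed.

Lemma cellE a b y : (forall i, a i <= b i) ->
  cell a b y = [forall i, a i <= y 0 i < b i]%R%:R.
Proof.
move=> ab; case: (boolP [forall i, _]) => [/forallP h|].
  rewrite /cell big1// => i _; have /andP[-> yb] := h i.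
  by rewrite leNgt yb subr0.
rewrite negb_forall => /existsP[i hi]; apply/eqP; rewrite prodf_seq_eq0.
apply/hasP; exists i; first by rewrite mem_index_enum.
move: hi; rewrite negb_and -leNgt -ltNge; case: (leP (b i) (y 0 i)) => [by_ _|yb].
  by rewrite (le_trans (ab i) by_) subrr eqxx.
by rewrite orbF => ya; rewrite leNgt ya subrr eqxx.
Qed.

Definition grid_pt (o delta : R) K (c : {ffun 'I_n -> 'I_K}) : 'rV[R]_n :=
  \row_i (o + (c i)%:R * delta).

Definition grid_step (f : 'rV[R]_n -> R) (o delta : R) (K : nat) y : R :=
  \sum_(c : {ffun 'I_n -> 'I_K}) f (grid_pt o delta c) *
     cell (fun i => o + (c i)%:R * delta) (fun i => o + (c i).+1%:R * delta) y.

(** The half-open cells partition the cube, so a single term of the sum survives, and [z] is the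
    lower corner of the cell of [y]. *)
Lemma grid_stepE (f : 'rV[R]_n -> R) (o delta : R) (K : nat) y : 0 < delta ->
  (forall i, o <= y 0 i < o + K%:R * delta) ->
  exists2 z : 'rV[R]_n, grid_step f o delta K y = f z &
    forall i, o <= z 0 i /\ z 0 i <= y 0 i /\ y 0 i < z 0 i + delta.
Proof.
move=> d0 hy.
pose k i := Num.truncn ((y 0 i - o) / delta).
have q0 i : 0 <= (y 0 i - o) / delta.
  by have /andP[h _] := hy i; rewrite divr_ge0 ?subr_ge0// ltW.
have kle i : o + (k i)%:R * delta <= y 0 i.
  by rewrite -lerBrDl -ler_pdivlMr// truncn_le.
have klt i : y 0 i < o + (k i).+1%:R * delta.
  by rewrite -ltrBlDl -ltr_pdivrMr// truncnS_gt.
have kK i : (k i < K)%N.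
  have /andP[_ h] := hy i; rewrite -(ltr_nat R) (le_lt_trans _ (_ : (y 0 i - o) / delta < _))//.
    by rewrite truncn_le.
  by rewrite ltr_pdivrMr// ltrBlDl.
pose c : {ffun 'I_n -> 'I_K} := [ffun i => Ordinal (kK i)].
exists (grid_pt o delta c); last first.
  move=> i; rewrite mxE ffunE/= kle; split; first by rewrite lerDl mulr_ge0// ltW.
  by split=> //; rewrite -addrA -[X in _ + (_ + X)]mul1r -mulrDl natr1.
have cellc : cell (fun i => o + (c i)%:R * delta) (fun i => o + (c i).+1%:R * delta) y = 1.
  rewrite cellE; last by move=> i; rewrite lerD2l ler_wpM2r ?ler_nat// ltW.
  case: (boolP [forall i, _]) => [_ //|/negP[]].
  by apply/forallP => i; rewrite ffunE/= kle klt.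
rewrite /grid_step (bigD1 c)//= cellc mulr1 big1 ?addr0// => c' c'c.
rewrite cellE; last by move=> i; rewrite lerD2l ler_wpM2r ?ler_nat// ltW.
case: (boolP [forall i, _]) => [/forallP h|_]; last by rewrite mulr0.
case/eqP : c'c; apply/ffunP => i; apply/val_inj; rewrite ffunE /=.
have /andP[h1 h2] := h i; apply/eqP; rewrite eqn_leq.
apply/andP; split; rewrite -ltnS -(ltr_nat R).
  by have := le_lt_trans h1 (klt i); rewrite ltrD2l ltr_pM2r.
by have := le_lt_trans (kle i) h2; rewrite ltrD2l ltr_pM2r.
Qed.
End rectangular_cells.

Section bounded_expectation.
Context (R : realType) d (T : measurableType d) (P : probability T R).

Lemma integrable_bounded (f : T -> R) (M : R) : measurable_fun setT f ->
  (forall w, `|f w| <= M) -> P.-integrable setT (EFin \o f).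
Proof.
move=> mf fM; apply: measurable_bounded_integrable => //.
  exact: fin_num_fun_lty.
exists M; split; first exact: num_real.
by move=> M' MM' w _ /=; rewrite (le_trans (fM w))// ltW.
Qed.

Lemma expectation_Rintegral (f : T -> R) : P.-integrable setT (EFin \o f) ->
  ('E_P[f] = (\int[P]_w f w)%R%:E)%E.
Proof. by move=> fi; rewrite unlock /Rintegral fineK// integrable_fin_num. Qed.

Lemma Rintegral_sum (I : finType) (h : I -> T -> R) :
  (forall i, P.-integrable setT (EFin \o h i)) ->
  \int[P]_w (\sum_i h i w) = \sum_i \int[P]_w h i w.
Proof.
move=> hi; rewrite /Rintegral.
under eq_integral do rewrite -sumEFin.
rewrite integral_sum// -sum_fine// => i _.
exact: integrable_fin_num (hi i).
Qed.

Lemma Rintegral_lincomb_indic (I : finType) (c : I -> R) (E : I -> set T) :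
  (forall i, measurable (E i)) ->
  \int[P]_w (\sum_i c i * \1_(E i) w) = \sum_i c i * fine (P (E i)).
Proof.
move=> mE; have iE i : P.-integrable setT (EFin \o \1_(E i)) by exact: integrable_indic.
rewrite Rintegral_sum => [|i]; last first.
  exact: (integrableZl measurableT (c i) (iE i)).
apply: eq_bigr => i _; rewrite RintegralZl//; congr (_ * fine _).
by rewrite integral_indic// setIT.
Qed.

(** The almost everywhere form serves the limit vector, which stays in the box only up to a null
    set. *)
Lemma ae_Rintegral_dist (f g : T -> R) (e : R) :
  P.-integrable setT (EFin \o f) -> P.-integrable setT (EFin \o g) ->
  (\forall w \ae P, `|f w - g w| <= e) -> 0 <= e ->
  `|\int[P]_w f w - \int[P]_w g w| <= e.
Proof.
move=> fi gi fge e0; rewrite -RintegralB//.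
have fgi : P.-integrable setT (EFin \o (fun w => f w - g w)).
  by apply: (integrableB measurableT fi gi).
apply: (le_trans (le_normr_Rintegral measurableT fgi)).
rewrite -lee_fin fineK; last first.
  have := integrable_norm fgi; exact: integrable_fin_num.
have -> : e%:E = (\int[P]_w e%:E)%E.
  by rewrite integral_cst//= probability_setT mule1.
apply: ae_ge0_le_integral => //.
- by have /measurable_int := integrable_norm fgi.
- by apply: filterS fge => w h _; rewrite lee_fin.
Qed.
End bounded_expectation.

Section orthant_vectors.
Context (R : realType) (n : nat) d (T : measurableType d) (P : probability T R)
  (Y : T -> 'rV[R]_n).
Hypothesis mY : forall i, measurable_fun setT (fun w => Y w 0 i).

Lemma measurable_orthant a : measurable (Y @^-1` orthant a).
Proof.
rewrite (_ : _ @^-1` _ = \bigcap_(i in [set: 'I_n]) [set w | a i <= Y w 0 i]); last first.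
  by apply/seteqP; split=> [w h i _ /=|w h i]; [exact: h|exact: h].
apply: fin_bigcap_measurable => // i _.
have := mY i measurableT (measurable_itv `[a i, +oo[).
rewrite setTI (_ : _ @^-1` _ = [set w | a i <= Y w 0 i])//.
by apply/seteqP; split=> w /=; rewrite in_itv/= andbT.
Qed.

Lemma grid_step_lincomb (f : 'rV[R]_n -> R) o delta K y :
  grid_step f o delta K y =
  \sum_(x : {ffun 'I_n -> 'I_K} * {set 'I_n})
    (f (grid_pt o delta x.1) * (-1) ^+ #|x.2|) *
    \1_(orthant (fun i => o + (x.1 i + (i \in x.2))%:R * delta)) y.
Proof.
rewrite /grid_step.
under eq_bigr do rewrite cell_expand mulr_sumr.
rewrite pair_big/=; apply: eq_bigr => -[c A] _ /=; rewrite mulrA; congr (_ * _).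
congr (\1_(orthant _) _); apply/funext => i.
by case: (i \in A); rewrite ?addn1 ?addn0.
Qed.

Lemma measurable_grid_step (f : 'rV[R]_n -> R) o delta K :
  measurable_fun setT (fun w => grid_step f o delta K (Y w)).
Proof.
under eq_fun do rewrite grid_step_lincomb.
apply: measurable_sum => x.
apply: measurable_funM => //.
set E := orthant _.
rewrite (_ : (fun w => _) = \1_(Y @^-1` E)).
  exact/measurable_indic/measurable_orthant.
by apply/funext => w; rewrite !indicE.
Qed.

Lemma Rintegral_grid_step (f : 'rV[R]_n -> R) o delta K :
  \int[P]_w grid_step f o delta K (Y w) =
  \sum_(x : {ffun 'I_n -> 'I_K} * {set 'I_n})
    (f (grid_pt o delta x.1) * (-1) ^+ #|x.2|) *
    fine (P (Y @^-1` orthant (fun i => o + (x.1 i + (i \in x.2))%:R * delta))).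
Proof.
rewrite -Rintegral_lincomb_indic; last by move=> x; exact: measurable_orthant.
apply: eq_Rintegral => w _; rewrite grid_step_lincomb.
by apply: eq_bigr => x _; rewrite !indicE.
Qed.

Lemma integrable_grid_step (f : 'rV[R]_n -> R) o delta K :
  P.-integrable setT (EFin \o (fun w => grid_step f o delta K (Y w))).
Proof.
apply: (@integrable_bounded _ _ _ _ _ (\sum_(x : {ffun 'I_n -> 'I_K} * {set 'I_n})
    `|f (grid_pt o delta x.1)|)).
  exact: measurable_grid_step.
move=> w; rewrite grid_step_lincomb; apply: le_trans (ler_norm_sum _ _ _) _.
apply: ler_sum => x _; rewrite !normrM normrX normrN1 expr1n mulr1.
by rewrite ler_piMr// indicE; case: (_ \in _); rewrite ?normr1 ?normr0.
Qed.

(** Only the coordinates of [Y] are known to be measurable. Grid step functions of [Y] are finite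
    combinations of indicators of orthants, and [f \o Y] is their pointwise limit. *)
Lemma measurable_continuous_comp (f : 'rV[R]_n -> R) : continuous f ->
  measurable_fun setT (f \o Y).
Proof.
move=> cf.
(* The cube from [- k.+1] to [k.+1] with mesh [1 / k.+1] has [2 * k.+1 * k.+1] cells along each
   side; it eventually contains [Y w]. *)
apply: (@measurable_fun_cvg _ _ _ setT
  (fun k w => grid_step f (- k.+1%:R) k.+1%:R^-1 (2 * k.+1 * k.+1) (Y w))).
  by move=> k; exact: measurable_grid_step.
move=> w _; apply/cvgrPdist_le => e e0.
have := cf (Y w); move/cvgrPdist_le => /(_ _ e0)/nbhs_ballP[r /= r0 fr].
near=> k.
have k0 : 0 < k.+1%:R :> R by rewrite ltr0n.
have kY : \sum_i `|Y w 0 i| < k.+1%:R.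
  by apply: (@lt_trans _ _ k%:R); [near: k; exact: nbhs_infty_gtr|rewrite ltr_nat].
have Yk i : `|Y w 0 i| < k.+1%:R.
  by apply: le_lt_trans kY; rewrite (bigD1 i)//= lerDl sumr_ge0.
have kr : k.+1%:R^-1 < r.
  rewrite invf_plt ?posrE//; apply: (@lt_trans _ _ k%:R); last by rewrite ltr_nat.
  by near: k; exact: nbhs_infty_gtr.
have [|i|z -> hz] := @grid_stepE _ _ f (- k.+1%:R) k.+1%:R^-1 (2 * k.+1 * k.+1) (Y w).
- by rewrite invr_gt0.
- have := Yk i; rewrite ltr_norml => /andP[h1 h2]; rewrite (ltW h1)/=.
  rewrite natrM mulfK ?lt0r_neq0// natrM.
  by apply: lt_le_trans h2 _; rewrite mulr2n mulrDl mul1r addrA addNr add0r.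
apply: fr; split => // i j; rewrite ord1 /ball/=.
have [_ [h1 h2]] := hz j.
rewrite ger0_norm ?subr_ge0//; apply: le_lt_trans kr.
by rewrite lerBlDl ltW.
Unshelve. all: by end_near. Qed.
End orthant_vectors.

(** Heine-Cantor through the near-covering form of compactness, with [eta] running along the filter
    [0^'+]. Half of the continuity radius is spent on moving the centre and half on moving [z],
    which may leave the cube. *)
Lemma box_uniform_continuity (R : realType) n (f : 'rV[R]_n -> R) (B e : R) :
  continuous f -> 0 < e ->
  exists2 eta : R, 0 < eta & forall x z : 'rV[R]_n,
    (forall i, 0 <= x 0 i <= B) -> (forall i, `|x 0 i - z 0 i| < eta) ->
    `|f x - f z| <= e.
Proof.
move=> cf e0.
pose K := [set v : 'rV[R]_n | forall i, `[0, B]%classic (v ord0 i)].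
have cK : compact K.
  by apply: (@rV_compact R n (fun=> `[0, B]%classic)) => _; exact: segment_compact.
have /compact_near_coveringP/(_ R (0^'+)
  (fun eta x => forall z : 'rV[R]_n,
    (forall i, `|x 0 i - z 0 i| < eta) -> `|f x - f z| <= e)) := cK.
case=> [x Kx|eta /= eta0 h].
  have := cf x; move/cvgrPdist_le => /(_ (e / 2)) /=; rewrite divr_gt0// => /(_ isT).
  move=> /nbhs_ballP[r /= r0 fr].
  exists (ball x (r / 2), [set eta | 0 < eta < r / 2]); first split.
  - by apply: nbhsx_ballx; rewrite divr_gt0.
  - near=> eta; apply/andP; split => //=.
    by near: eta; apply: nbhs_right_lt; rewrite divr_gt0.
  move=> [x' eta] /= [xx' /andP[eta0 etar]] z hz.
  rewrite (le_trans (ler_distD (f x) _ _))// [e]splitr lerD//.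
    rewrite distrC; apply: fr; apply: le_ball xx'.
    by rewrite ler_pdivrMr// ler_peMr ?ler1n// ltW.
  apply: fr; rewrite [r]splitr; apply: (ball_triangle xx').
  split=> [|i j]; first by rewrite divr_gt0.
  by rewrite ord1 /ball/=; apply: lt_trans etar.
have eta20 : 0 < eta / 2 by rewrite divr_gt0.
have {}h : K `<=` (fun x => forall z : 'rV[R]_n,
    (forall i, `|x 0 i - z 0 i| < eta / 2) -> `|f x - f z| <= e).
  apply: h => //; rewrite /ball/= sub0r normrN gtr0_norm//.
  by rewrite ltr_pdivrMr// ltr_pMr// ltr1n.
exists (eta / 2); first by rewrite divr_gt0.
by move=> x z Bx; apply: h => i /=; rewrite in_itv/=; exact: Bx.
Unshelve. all: by end_near. Qed.

(** Boundedness, for large [m] on one side and almost surely on the other, replaces tightness. The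
    grid starts at the origin, so only nonnegative thresholds occur. The error splits into three
    thirds: two approximations by the step function, and the convergence of its integral. *)
Lemma cvg_in_distribution_orthant (R : realType) n
    (d : nat -> measure_display) (T : forall m, measurableType (d m))
    (P : forall m, probability (T m) R) (Y : forall m, T m -> 'rV[R]_n)
    d' (S : measurableType d') (Q : probability S R) (Z : S -> 'rV[R]_n) (B : R) :
  (forall m i, measurable_fun setT (fun w => @Y m w 0 i)) ->
  (forall i, measurable_fun setT (fun w => Z w 0 i)) ->
  (\forall m \near \oo, forall w i, 0 <= @Y m w 0 i <= B) ->
  (\forall w \ae Q, forall i, 0 <= Z w 0 i <= B) ->
  (forall a : 'I_n -> R, (forall i, 0 <= a i) -> \sum_i a i != 1 ->
    P m (@Y m @^-1` orthant a) @[m --> \oo] --> Q (Z @^-1` orthant a)) ->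
  cvg_in_distribution P Y Q Z.
Proof.
move=> mY mZ YB ZB YZ f cf [M fM].
have iY m : (P m).-integrable setT (EFin \o (f \o @Y m)).
  by apply: (@integrable_bounded _ _ _ _ _ M) => [|w];
    [exact: measurable_continuous_comp|exact: fM].
have iZ : Q.-integrable setT (EFin \o (f \o Z)).
  by apply: (@integrable_bounded _ _ _ _ _ M) => [|w];
    [exact: measurable_continuous_comp|exact: fM].
under eq_cvg do rewrite (expectation_Rintegral (iY _)).
rewrite (expectation_Rintegral iZ).
apply: cvg_EFin; first exact: nearW.
apply/cvgrPdist_le => e e0.
have e30 : 0 < e / 3 by rewrite divr_gt0.
have [eta eta0 fu] := box_uniform_continuity B cf e30.
(* The odd denominator [2 k + 1] keeps every sum of grid coordinates away from 1,
   where the limiting survival function jumps when n = 1. *)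
have [k keta] : exists k : nat, 2 / (2 * k%:R + 1) < eta.
  exists (Num.truncn (1 / eta)).+1.
  have := truncnS_gt (1 / eta); set k := _.+1; rewrite ltr_pdivrMr// => h.
  rewrite ltr_pdivrMr ?ltr_wpDl ?mulr_ge0//.
  have : 0 <= k%:R :> R by [].
  nra.
pose delta : R := 2 / (2 * k%:R + 1).
have kk0 : 0 < 2 * k%:R + 1 :> R by rewrite ltr_wpDl// mulr_ge0.
have d0 : 0 < delta by rewrite divr_gt0.
pose K := (Num.truncn (B / delta)).+1.
have BK : B < 0 + K%:R * delta by rewrite add0r -ltr_pdivrMr// truncnS_gt.
pose g := grid_step f 0 delta K.
have fg (y : 'rV[R]_n) : (forall i, 0 <= y 0 i <= B) -> `|f y - g y| <= e / 3.
  move=> hy; rewrite /g; have [//||z -> hz] := @grid_stepE _ _ f 0 delta K y.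
    by move=> i; have /andP[-> /le_lt_trans->] := hy i.
  apply: fu => // i; have [_ [h1 h2]] := hz i.
  by rewrite ger0_norm ?subr_ge0// (lt_trans _ keta)// ltrBlDl.
have gcvg : \int[P m]_w g (@Y m w) @[m --> \oo] --> \int[Q]_w g (Z w).
  rewrite Rintegral_grid_step//.
  under eq_cvg do rewrite Rintegral_grid_step//.
  apply: cvg_sumr => x; apply: cvgM; first exact: cvg_cst.
  apply: fine_cvg; rewrite fineK ?fin_num_measure//; last exact: measurable_orthant.
  apply: YZ => [i|]; first by rewrite add0r mulr_ge0// ltW.
  under eq_bigr do rewrite add0r.
  rewrite -mulr_suml -natr_sum /delta; set N := (\sum_(_ < _) _)%N.
  apply/eqP => h.
  have : N%:R * 2 = 2 * k%:R + 1 :> R.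
    move: h; rewrite mulrA => /(congr1 (fun t => t * (2 * k%:R + 1))).
    by rewrite divfK ?lt0r_neq0// mul1r.
  rewrite -natrM -natrM natr1 => /eqP; rewrite eqr_nat => /eqP/(congr1 odd).
  by rewrite oddM andbF /= oddM.
have gY m : (P m).-integrable setT (EFin \o (fun w => g (@Y m w))) by exact: integrable_grid_step.
have gZ : Q.-integrable setT (EFin \o (fun w => g (Z w))) by exact: integrable_grid_step.
have dZ : `|\int[Q]_w (f \o Z) w - \int[Q]_w g (Z w)| <= e / 3.
  apply: ae_Rintegral_dist => //; last exact: ltW.
  by apply: filterS ZB => w /= h; exact: fg.
move/cvgrPdist_le : gcvg => /(_ _ e30) gcvg.
near=> m.
have dY : `|\int[P m]_w (f \o @Y m) w - \int[P m]_w g (@Y m w)| <= e / 3.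
  apply: ae_Rintegral_dist => //; last exact: ltW.
  apply: aeW => w /=; apply: fg; move: w; near: m; exact: YB.
have dg : `|\int[Q]_w g (Z w) - \int[P m]_w g (@Y m w)| <= e / 3 by near: m.
rewrite /=; move: dY dZ dg; rewrite !ler_norml.
move: (\int[Q]_w _) (\int[Q]_w _) (\int[P m]_w _) (\int[P m]_w _) => a b c' c.
lra.
Unshelve. all: by end_near. Qed.

(** * Law of the maximal coordinate *)

Definition row_max (R : realType) n (y : 'rV[R]_n) : R := \big[Num.max/0]_(i < n) y 0 i.

Section row_max.
Context (R : realType) (n : nat).
Implicit Types y : 'rV[R]_n.

Lemma row_max_ge0 y : 0 <= row_max y.
Proof. exact: bigmax_ge_id. Qed.

Lemma row_max_ltP y r : 0 < r -> reflect (forall i, y 0 i < r) (row_max y < r).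
Proof.
move=> r0; apply: (iffP (bigmax_ltP _ _ _ _)) => [[_ h] i|h]; first exact: h.
by split.
Qed.

Lemma row_max_le y B : 0 <= B -> (forall i, y 0 i <= B) -> row_max y <= B.
Proof. by move=> B0 yB; apply: bigmax_le. Qed.

Lemma continuous_row_max : continuous (@row_max R n).
Proof.
apply: (@continuous_big R^o _ Num.max 0 xpredT _ 'rV[R]_n _ (fun i y => y 0 i)).
  move=> x; apply: continuous_max; [exact: cvg_fst|exact: cvg_snd].
by move=> i _; exact: coord_continuous.
Qed.
End row_max.

Lemma sum_powerset_card (R : realType) n (F : nat -> R) :
  \sum_(A : {set 'I_n}) F #|A| = \sum_(k < n.+1) 'C(n, k)%:R * F k.
Proof.
rewrite (partition_big (fun A : {set 'I_n} => inord #|A| : 'I_n.+1) xpredT)//=.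
have cardA (A : {set 'I_n}) : (#|A| < n.+1)%N.
  by rewrite ltnS -[leqRHS]card_ord max_card.
apply: eq_bigr => k _; rewrite (eq_bigr (fun=> F k)); last first.
  by move=> A /eqP <-; rewrite inordK.
rewrite sumr_const -[LHS]mulr_natl; congr (_%:R * _).
rewrite -[n in 'C(n, _)]card_ord -card_draws; apply: eq_card => A.
rewrite [RHS]inE (_ : (A \in _) = ((inord #|A| : 'I_n.+1) == k))//.
by rewrite -val_eqE /= inordK.
Qed.

Section max_law.
Context (R : realType) (p : nat) d (S : measurableType d) (Q : probability S R)
  (Y : S -> 'rV[R]_p.+1).
Hypothesis mY : forall i, measurable_fun setT (fun w => Y w 0 i).
Hypothesis survival : forall a : 'I_p.+1 -> R, (forall i, 0 <= a i) ->
  Q (Y @^-1` orthant a) = (pospow p (1 - \sum_i a i))%:E.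

Lemma ae_ge0 : \forall w \ae Q, forall i, 0 <= Y w 0 i.
Proof.
exists (~` (Y @^-1` orthant (fun=> 0))); split.
- exact/measurableC/measurable_orthant.
- rewrite [LHS]probability_setC; last exact: measurable_orthant.
  by rewrite survival// big1// subr0 /pospow ler01 expr1n subee.
- by move=> w /= h h'; apply: h => i; exact: h'.
Qed.

(** The survival function vanishes at the threshold 2, whereas at 1 it equals 1 when [p = 0]. The
    orthant used also requires the other coordinates to be nonnegative, hence the second null
    set. *)
Lemma ae_le2 : \forall w \ae Q, forall i, Y w 0 i <= 2.
Proof.
suff h i : \forall w \ae Q, Y w 0 i <= 2.
  exact: filter_forall h.
exists ((Y @^-1` orthant (fun j => if j == i then 2 else 0)) `|`
   ~` (Y @^-1` orthant (fun=> 0))); split.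
- by apply: measurableU; [|apply: measurableC]; exact: measurable_orthant.
- apply/eqP; rewrite -measure_le0; apply: le_trans (measureU2 _ _ _) _ => //=.
  + exact: measurable_orthant.
  + exact/measurableC/measurable_orthant.
  + rewrite survival; last by move=> j; case: ifP.
    rewrite (bigD1 i)//= eqxx big1 ?addr0; last by move=> j /negPf ->.
    rewrite /pospow ifF; last by apply/negbTE; rewrite -ltNge; lra.
    rewrite add0e [leLHS]probability_setC; last exact: measurable_orthant.
    by rewrite survival// big1// subr0 /pospow ler01 expr1n subee.
- move=> w /= /negP; rewrite -ltNge => Y2.
  have [h|h] := pselect (forall j, 0 <= Y w 0 j); [left|right] => // j.
  by case: eqP => [->|_]; [exact: ltW|exact: h].
Qed.

Lemma ae_box : \forall w \ae Q, forall i, 0 <= Y w 0 i <= 2.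
Proof. by apply: filterS2 ae_ge0 ae_le2 => w h0 h2 i; rewrite h0 h2. Qed.

Lemma measurable_row_max : measurable_fun setT (fun w => row_max (Y w)).
Proof. exact: (measurable_continuous_comp mY (@continuous_row_max R p.+1)). Qed.

(** Up to a null set the event is the cell between 0 and [r]. In its expansion the orthant of [A]
    has thresholds of sum [#|A| * r], so terms of equal cardinality can be grouped. *)
Lemma probability_row_max_lt r : 0 < r ->
  Q [set w | row_max (Y w) < r] =
  (\sum_(k < p.+2) 'C(p.+1, k)%:R * ((-1) ^+ k * pospow p (1 - k%:R * r)))%:E.
Proof.
move=> r0.
have mlt : measurable [set w | row_max (Y w) < r].
  have := measurable_row_max measurableT (measurable_itv `]-oo, r[).
  by rewrite setTI (_ : _ @^-1` _ = [set w | row_max (Y w) < r]).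
have <- : \int[Q]_w \1_[set w | row_max (Y w) < r] w =
  \sum_(k < p.+2) 'C(p.+1, k)%:R * ((-1) ^+ k * pospow p (1 - k%:R * r)).
  transitivity (\int[Q]_w cell (fun=> 0) (fun=> r) (Y w)).
    congr fine; apply: ae_eq_integral => //.
    - exact/measurable_EFinP/measurable_indic.
    - apply/measurable_EFinP.
      under eq_fun do rewrite cell_expand.
      apply: measurable_sum => A; apply: measurable_funM => //.
      set E := orthant _.
      rewrite (_ : (fun w => _) = \1_(Y @^-1` E)).
        exact/measurable_indic/measurable_orthant.
      by apply/funext => w; rewrite !indicE.
    - apply: filterS ae_ge0 => w Yw _; congr EFin.
      rewrite cellE; last by move=> i; exact: ltW.
      rewrite indicE; congr ((nat_of_bool _)%:R).
      apply/idP/forallP => [|h]; first by rewrite inE => /(row_max_ltP (Y w) r0) h i; rewrite Yw h.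
      by rewrite inE; apply/(row_max_ltP (Y w) r0) => i; case/andP : (h i).
  rewrite -(sum_powerset_card p.+1 (fun k => (-1) ^+ k * pospow p (1 - k%:R * r))).
  transitivity (\int[Q]_w (\sum_(A : {set 'I_p.+1}) (-1) ^+ #|A| *
    \1_(Y @^-1` orthant (fun i => if i \in A then r else 0)) w)).
    apply: eq_Rintegral.
    by move=> w _; rewrite cell_expand; apply: eq_bigr => A _; rewrite !indicE.
  rewrite Rintegral_lincomb_indic; last by move=> A; exact: measurable_orthant.
  apply: eq_bigr => A _; rewrite survival; last by move=> i; case: ifP => // _; exact: ltW.
  by rewrite /= -big_mkcond/= sumr_const mulr_natl.
by rewrite /Rintegral integral_indic// setIT fineK// fin_num_measure.
Qed.
End max_law.

(** For [k > 0] the argument approaches [1 - k r] from below; when [1 - k r <= 0] it is negative all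
    along, so the limit is 0 even at [1 - k r = 0]. This is how the strict version arises. *)
Lemma pospow_right_cvg (R : realType) p (k : nat) (r : R) :
  pospow p (1 - k%:R * (r + j.+1%:R^-1)) @[j --> \oo] --> pospow_strict p (1 - k%:R * r).
Proof.
have jcvg : (j.+1%:R^-1 : R) @[j --> \oo] --> (0 : R).
  by have := @cvg_natr_invr R; rewrite -cvg_shiftS.
have acvg : 1 - k%:R * (r + j.+1%:R^-1) @[j --> \oo] --> 1 - k%:R * r.
  rewrite -[in X in _ --> X](addr0 r).
  apply: cvgB; first exact: cvg_cst.
  by apply: cvgM; [exact: cvg_cst|apply: cvgD => //; exact: cvg_cst].
rewrite /pospow_strict; case: ltP => [pos|neg].
  have : (1 - k%:R * (r + j.+1%:R^-1)) ^+ p @[j --> \oo] --> (1 - k%:R * r) ^+ p.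
    by apply: (cvg_comp _ (fun x => x ^+ p) acvg); exact: exprn_continuous.
  apply: cvg_trans; apply: near_eq_cvg; near=> j.
  rewrite /pospow ifT//; near: j.
  have : \forall j \near \oo, 0 < 1 - k%:R * (r + j.+1%:R^-1) by apply: (cvgr_gt _ acvg).
  by apply: filterS => j; exact: ltW.
have k0 : 0 < k%:R :> R.
  rewrite ltr0n lt0n; apply/eqP => k0; move: neg; rewrite k0 mul0r subr0; lra.
apply: cvg_near_cst; near=> j.
rewrite /pospow ifF//; apply/negbTE; rewrite -ltNge.
have : 0 < k%:R * j.+1%:R^-1 :> R by rewrite mulr_gt0// invr_gt0 ltr0n.
move: neg; rewrite mulrDr; move: (k%:R * r) (k%:R / _) => a b; lra.
Unshelve. all: by end_near. Qed.

Lemma sum_alt_bin (R : realType) (n : nat) : (0 < n)%N ->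
  \sum_(k < n.+1) 'C(n, k)%:R * (-1) ^+ k = 0 :> R.
Proof.
move=> n0; have := exprBn (1 : R) 1 n; rewrite subrr expr0n gtn_eqF//= => h.
rewrite [RHS]h; apply: eq_bigr => k _.
by rewrite !expr1n !mulr1 mulr_natl.
Qed.

Section cdf_max.
Context (R : realType) (p : nat) d (S : measurableType d) (Q : probability S R)
  (M : {RV Q >-> R}).
Hypothesis M_lt : forall r, 0 < r -> Q [set w | M w < r] =
  (\sum_(k < p.+2) 'C(p.+1, k)%:R * ((-1) ^+ k * pospow p (1 - k%:R * r)))%:E.

(** The probability of [M < r + 1 / j.+1] lies between the distribution function at [r] and at
    [r + 1 / j.+1]; right continuity then identifies its limit. This also reaches [r = 0], which
    [M_lt] leaves out. *)
Lemma cdf_maxE r : 0 <= r -> cdf M r =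
  (\sum_(k < p.+2) 'C(p.+1, k)%:R * ((-1) ^+ k * pospow_strict p (1 - k%:R * r)))%:E.
Proof.
move=> r0.
have fcdf : cdf M r = (fine (cdf M r))%:E by rewrite fineK// fin_num_measure.
have upper : cdf M (r + j.+1%:R^-1) @[j --> \oo] --> cdf M r.
  have : cdf M x @[x --> r^'+] --> (fine (cdf M r))%:E.
    by rewrite -fcdf; exact: cdf_right_continuous.
  rewrite [X in _ -> _ --> X]fcdf => /cvge_at_rightP; apply; split => [j|].
    by rewrite ltrDl invr_gt0.
  rewrite -[X in _ --> X]addr0; apply: cvgD; first exact: cvg_cst.
  by have := @cvg_natr_invr R; rewrite -cvg_shiftS.
have mid : Q [set w | M w < r + j.+1%:R^-1] @[j --> \oo] --> cdf M r.
  have lower : cdf M r @[j --> \oo] --> cdf M r by exact: cvg_cst.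
  apply: squeeze_cvge lower upper; apply: nearW => j.
  have mlt : measurable [set w | M w < r + j.+1%:R^-1].
    have := measurable_funPTI M (measurable_itv `]-oo, r + j.+1%:R^-1[).
    by rewrite (_ : _ @^-1` _ = [set w | M w < r + j.+1%:R^-1]).
  have mle (t : R) : measurable (M @^-1` `]-oo, t]) by exact: measurable_funPTI.
  apply/andP; split.
  - apply: (@le_measure _ _ _ Q (M @^-1` `]-oo, r])); rewrite ?inE//.
    by move=> w /=; rewrite in_itv/= => /le_lt_trans; apply; rewrite ltrDl invr_gt0.
  - apply: (@le_measure _ _ _ Q _ (M @^-1` `]-oo, r + j.+1%:R^-1])); rewrite ?inE//.
    by move=> w /=; rewrite in_itv/= => /ltW.
have rhs : Q [set w | M w < r + j.+1%:R^-1] @[j --> \oo] -->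
    (\sum_(k < p.+2) 'C(p.+1, k)%:R * ((-1) ^+ k * pospow_strict p (1 - k%:R * r)))%:E.
  under eq_cvg do rewrite M_lt ?ltr_wpDl ?invr_gt0//.
  apply: cvg_EFin; first exact: nearW.
  apply: cvg_sumr => k; apply: cvgM; first exact: cvg_cst.
  by apply: cvgM; [exact: cvg_cst|exact: pospow_right_cvg].
exact: (cvg_unique _ mid rhs).
Qed.

Lemma ccdf_maxE r : 0 <= r -> ccdf M r =
  (\sum_(k < p.+1) 'C(p.+1, k.+1)%:R * (-1) ^+ k * pospow_strict p (1 - k.+1%:R * r))%:E.
Proof.
move=> r0; rewrite ccdf_1_cdf cdf_maxE// big_ord_recl -EFinB; congr EFin.
rewrite mul0r subr0 {1}/pospow_strict ltr01 expr1n bin0 expr0 !mulr1 opprD addrA subrr add0r.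
rewrite -sumrN; apply: eq_bigr => k _ /=.
by rewrite /bump/= add1n exprS; ring.
Qed.
End cdf_max.

(** * Moments of the maximum by integration of its tail *)

Lemma ge0_expectation_lincomb (R : realType) d (S : measurableType d) (Q : probability S R)
    (M : {RV Q >-> R}) (N : nat) (c I : 'I_N -> R) (h : 'I_N -> R -> R) :
  (forall w, 0 <= M w) ->
  (forall r, 0 <= r -> ccdf M r = (\sum_k c k * h k r)%:E) ->
  (forall k, lebesgue_measure.-integrable `[0, +oo[ (EFin \o h k)) ->
  (forall k, \int[lebesgue_measure]_(r in `[0%R, +oo[) (h k r)%:E = (I k)%:E)%E ->
  ('E_Q[M] = (\sum_k c k * I k)%:E)%E.
Proof.
move=> M0 cM ih Ih; rewrite ge0_expectation_ccdf//.
transitivity (\int[lebesgue_measure]_(r in `[0%R, +oo[) (\sum_k (c k)%:E * (h k r)%:E))%E.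
  apply: eq_integral => r; rewrite inE/= in_itv/= andbT => r0.
  by rewrite cM// -sumEFin; apply: eq_bigr => k _; rewrite EFinM.
rewrite integral_sum//; last by move=> k; exact: (integrableZl _ (c k) (ih k)).
rewrite -sumEFin; apply: eq_bigr => k _.
by rewrite integralZl//; [rewrite Ih EFinM|exact: ih].
Qed.

(** The functions [f] and [h] may differ at [B]: when [p = 0], [h] drops there from 1 to 0.
    Integrals ignore this point. *)
Lemma integral_truncated (R : realType) (f h : R -> R) (B : R) :
  0 <= B -> continuous f -> (forall r, 0 <= r -> r < B -> h r = f r) ->
  (forall r, B <= r -> h r = 0) ->
  lebesgue_measure.-integrable `[0, +oo[ (EFin \o h) /\
  (\int[lebesgue_measure]_(r in `[0%R, +oo[) (h r)%:E =
   \int[lebesgue_measure]_(r in `[0%R, B]) (f r)%:E)%E.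
Proof.
move=> B0 cf hf h0.
have hE r : 0 <= r -> (h r)%:E = ((EFin \o f) \_ `[0, B[) r.
  move=> r0; rewrite patchE; have [rB|Br] := ltP r B.
    by rewrite mem_set ?hf//= in_itv/= r0 rB.
  by rewrite memNset ?h0//= in_itv/= r0/= ltNge Br.
have capE : `[0, +oo[ `&` `[0, B[ = `[0, B[%classic :> set R.
  apply/seteqP; split=> [r []//|r /= rB]; split => //.
  by move: rB; rewrite /= !in_itv/= andbT => /andP[].
have mf : measurable_fun setT f by exact: continuous_measurable_fun.
have if' : lebesgue_measure.-integrable `[0, B[ (EFin \o f).
  have ic : lebesgue_measure.-integrable `[0, B] (EFin \o f).
    apply: continuous_compact_integrable; first exact: segment_compact.
    exact: continuous_subspaceT.
  by apply: integrableS ic => //; apply: subset_itvl; rewrite bnd_simp.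
have ip : lebesgue_measure.-integrable setT ((EFin \o f) \_ `[0, B[).
  have [h1 _] := @integrable_mkcond _ _ R lebesgue_measure _ (EFin \o f) (measurable_itv `[0, B[).
  exact: h1.
have iD : lebesgue_measure.-integrable `[0, +oo[ ((EFin \o f) \_ `[0, B[).
  by apply: integrableS ip.
split.
  by apply: eq_integrable iD => // r; rewrite inE/= in_itv/= andbT => r0; rewrite -hE.
transitivity (\int[lebesgue_measure]_(r in `[0%R, +oo[) ((EFin \o f) \_ `[0%R, B[) r)%E.
  by apply: eq_integral => r; rewrite inE/= in_itv/= andbT => r0; rewrite hE.
rewrite -integral_mkcondr capE integral_itv_bndo_bndc//.
exact/measurable_EFinP/measurable_funTS.
Qed.

Lemma is_derive_pow_div (R : realType) (q : nat) (x : R) :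
  is_derive x 1 (fun y : R => y ^+ q.+1 / q.+1%:R) (x ^+ q).
Proof.
have -> : (fun y : R => y ^+ q.+1 / q.+1%:R) = q.+1%:R^-1 \*: ((fun y : R => y) ^+ q.+1).
  by apply/funext => y; rewrite exprfctE mulrC.
apply: is_derive_eq.
by rewrite /GRing.scale/=; field; rewrite nat1r pnatr_eq0.
Qed.

Lemma integral_pospow_strict (R : realType) p k :
  let h r := pospow_strict p (1 - k.+1%:R * r) in
  (@lebesgue_measure R).-integrable `[0, +oo[ (EFin \o h) /\
  (\int[lebesgue_measure]_(r in `[0%R, +oo[) (h r)%:E =
    (k.+1%:R^-1 / p.+1%:R)%:E)%E.
Proof.
move=> h; set c : R := k.+1%:R; have c0 : 0 < c by rewrite ltr0n.
pose F (r : R) := - c^-1 * ((1 - c * r) ^+ p.+1 / p.+1%:R).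
have dF (x : R) : is_derive x 1 F ((1 - c * x) ^+ p).
  have d1 : is_derive x 1 (fun r : R => 1 - c * r) (- c).
    have -> : (fun r : R => 1 - c * r) = cst 1 - (c \*: (fun r : R => r)) by apply/funext.
    by apply: is_derive_eq; rewrite sub0r /GRing.scale/= mulr1.
  have d2 := @is_derive1_comp R _ (fun r : R => 1 - c * r) x _ _
    (is_derive_pow_div p (1 - c * x)) d1.
  have -> : F = (- c^-1) \*: ((fun y : R => y ^+ p.+1 / p.+1%:R) \o (fun r : R => 1 - c * r)).
    by apply/funext.
  apply: is_derive_eq; rewrite /GRing.scale/=; field; exact: lt0r_neq0.
have cf : continuous (fun r : R => (1 - c * r) ^+ p).
  move=> x; apply: (@continuous_comp _ _ _ (fun x => 1 - c * x) (fun y => y ^+ p)).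
    by apply: cvgB; [exact: cvg_cst|apply: cvgM; [exact: cvg_cst|exact: cvg_id]].
  exact: exprn_continuous.
have [||||ih Ih] := @integral_truncated R (fun r => (1 - c * r) ^+ p) h c^-1.
- by rewrite invr_ge0 ltW.
- exact: cf.
- by move=> r r0 rc; rewrite /h /pospow_strict subr_gt0 -/c -ltr_pdivlMl// mulr1 rc.
- by move=> r cr; rewrite /h /pospow_strict subr_gt0 -/c -ltr_pdivlMl// mulr1 ltNge cr.
split=> //; rewrite Ih (@integral_antiderivative _ _ F)//.
- rewrite /F mulfV ?lt0r_neq0// subrr expr0n/= mul0r !mulr0 subr0 expr1n sub0r.
  by congr EFin; rewrite mulNr opprK mul1r.
- by rewrite invr_ge0 ltW.
- by move=> x; apply/differentiable_continuous/derivable1_diffP; case: (dF x).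
Qed.

Lemma integral_pospow_strict_sqrt (R : realType) p k :
  let h r := pospow_strict p (1 - k.+1%:R * Num.sqrt r) in
  (@lebesgue_measure R).-integrable `[0, +oo[ (EFin \o h) /\
  (\int[lebesgue_measure]_(r in `[0%R, +oo[) (h r)%:E =
    (2 * k.+1%:R ^- 2 / (p.+1%:R * p.+2%:R))%:E)%E.
Proof.
move=> h; set c : R := k.+1%:R; have c0 : 0 < c by rewrite ltr0n.
pose G q (y : R) := y ^+ q.+1 / q.+1%:R.
pose v (r : R) := 1 - c * Num.sqrt r.
(* Substituting [v = 1 - c sqrt r] gives [dr = - 2 c^-2 (1 - v) dv], so [v^p] has to be integrated
   against [1 - v]; hence the difference of two consecutive powers. *)
pose F (r : R) := - (2 * c ^- 2) * (G p (v r) - G p.+1 (v r)).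
have dF (x : R) : 0 < x -> is_derive x 1 F (v x ^+ p).
  move=> x0; have sx : 0 < Num.sqrt x by rewrite sqrtr_gt0.
  have d1 : is_derive x 1 v (- c * (2 * Num.sqrt x)^-1).
    have -> : v = cst 1 - (c \*: @Num.sqrt R) by apply/funext.
    have ds := is_derive1_sqrt x0.
    apply: (is_derive_eq (is_deriveB (is_derive_cst (1 : R) x 1) (is_deriveZ c ds))).
    by rewrite sub0r /GRing.scale/= mulNr.
  have d2 := @is_derive1_comp R _ v x _ _ (is_derive_pow_div p (v x)) d1.
  have d3 := @is_derive1_comp R _ v x _ _ (is_derive_pow_div p.+1 (v x)) d1.
  have -> : F = (- (2 * c ^- 2)) \*: ((G p \o v) - (G p.+1 \o v)).
    by apply/funext.
  apply: is_derive_eq; rewrite /GRing.scale/= [v x ^+ p.+1]exprS.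
  move: (v x ^+ p) => z; have -> : v x = 1 - c * Num.sqrt x by [].
  by field; rewrite !lt0r_neq0.
have cv : continuous v.
  by move=> x; apply: cvgB; [exact: cvg_cst|apply: cvgM; [exact: cvg_cst|exact: sqrt_continuous]].
have cX q : continuous (fun r => v r ^+ q).
  move=> x; apply: (@continuous_comp _ _ _ v (fun y => y ^+ q)); first exact: cv.
  exact: exprn_continuous.
have cF : continuous F.
  move=> x; apply: cvgM; first exact: cvg_cst.
  apply: cvgB; apply: cvgM; [exact: cX|exact: cvg_cst|exact: cX|exact: cvg_cst].
have sq : Num.sqrt (c ^- 2) = c^-1.
  by rewrite -exprVn sqrtr_sqr ger0_norm// invr_ge0 ltW.
have c2 : 0 <= c ^- 2 by rewrite invr_ge0 exprn_ge0// ltW.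
have [||||ih Ih] := @integral_truncated R (fun r => v r ^+ p) h (c ^- 2).
- exact: c2.
- exact: cX.
- move=> r r0 rc; rewrite /h /pospow_strict subr_gt0 -/c -ltr_pdivlMl// mulr1 -sq.
  by rewrite ltr_sqrt ?rc// invr_gt0 exprn_gt0.
- move=> r cr; rewrite /h /pospow_strict subr_gt0 -/c -ltr_pdivlMl// mulr1 -sq.
  by rewrite ltNge ler_sqrt ?cr//; apply: le_trans cr.
split=> //; rewrite Ih (@integral_antiderivative _ _ F _ _ c2 (cX p) cF (fun x x0 _ => dF x x0)).
congr EFin; rewrite /F /G /v sq sqrtr0 mulr0 subr0 mulfV ?lt0r_neq0// subrr !expr0n/= !mul0r.
rewrite !expr1n !mul1r subr0 mulr0 sub0r.
by field; rewrite -natrD !nat1r !pnatr_eq0.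
Qed.

(** For [n > 0] this is the complete homogeneous symmetric polynomial of degree [j] in 1, 1/2, ...,
    1/n, which explains the values [H_1] for [j = 1] and [(H_1^2 + H_2) / 2] for [j = 2]. *)
Definition alt_bin_sum (R : realType) (j n : nat) : R :=
  \sum_(k < n) 'C(n, k.+1)%:R * (-1) ^+ k * k.+1%:R ^- j.

Lemma alt_bin_sum0 (R : realType) n : alt_bin_sum R 0 n.+1 = 1.
Proof.
have := sum_alt_bin R (ltn0Sn n); rewrite big_ord_recl bin0 expr0 mulr1 => /eqP.
rewrite addrC addr_eq0 => /eqP h; apply: oppr_inj; rewrite -h /alt_bin_sum -sumrN.
by apply: eq_bigr => k _; rewrite expr0 invr1 mulr1 exprS mulN1r mulrN.
Qed.

(** Pascal's rule splits ['C(n.+1, k.+1)]; in the part with ['C(n, k)], the absorption identity [(n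
    + 1) C(n, k) = (k + 1) C(n + 1, k + 1)] trades one factor [1 / (k + 1)] for [1 / (n + 1)]. *)
Lemma alt_bin_sumS (R : realType) j n :
  alt_bin_sum R j.+1 n.+1 = alt_bin_sum R j.+1 n + alt_bin_sum R j n.+1 / n.+1%:R.
Proof.
rewrite /alt_bin_sum.
have -> : \sum_(k < n) 'C(n, k.+1)%:R * (-1) ^+ k * k.+1%:R ^- j.+1 =
   \sum_(k < n.+1) 'C(n, k.+1)%:R * (-1) ^+ k * k.+1%:R ^- j.+1 :> R.
  by rewrite big_ord_recr/= bin_small// !mul0r addr0.
rewrite mulr_suml -big_split/=; apply: eq_bigr => k _.
have kn : k.+1%:R != 0 :> R by rewrite pnatr_eq0.
have nn : n.+1%:R != 0 :> R by rewrite pnatr_eq0.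
have : n.+1%:R * 'C(n, k)%:R = k.+1%:R * 'C(n.+1, k.+1)%:R :> R by rewrite -!natrM mul_bin_diag.
move=> /(canRL (mulKf nn)) EB.
have BDE : 'C(n.+1, k.+1)%:R = 'C(n, k.+1)%:R + 'C(n, k)%:R :> R by rewrite binS natrD.
rewrite [LHS](_ : _ = ('C(n, k.+1)%:R + 'C(n, k)%:R) * (-1) ^+ k * k.+1%:R ^- j.+1); last first.
  by rewrite -BDE.
rewrite EB exprS; field; rewrite !nat1r kn nn /=.
by rewrite expf_neq0.
Qed.

Lemma HsumS (R : realType) k n : Hsum R k n.+1 = Hsum R k n + n.+1%:R ^- k.
Proof. by rewrite /Hsum big_nat_recr. Qed.

Lemma alt_bin_sum1 (R : realType) n : alt_bin_sum R 1 n = Hsum R 1 n.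
Proof.
elim: n => [|n IH]; first by rewrite /alt_bin_sum /Hsum big_ord0 big_geq.
by rewrite alt_bin_sumS IH HsumS alt_bin_sum0 expr1 div1r.
Qed.

Lemma alt_bin_sum2 (R : realType) n :
  alt_bin_sum R 2 n = (Hsum R 1 n ^+ 2 + Hsum R 2 n) / 2.
Proof.
elim: n => [|n IH]; first by rewrite /alt_bin_sum /Hsum big_ord0 !big_geq// expr0n addr0 mul0r.
rewrite alt_bin_sumS IH !HsumS alt_bin_sum1 HsumS expr1.
by field; rewrite nat1r pnatr_eq0.
Qed.

Section max_moments.
Context (R : realType) (p : nat) d (S : measurableType d) (Q : probability S R)
  (M M2 : {RV Q >-> R}).
Hypothesis M_ge0 : forall w, 0 <= M w.
Hypothesis M_lt : forall r, 0 < r -> Q [set w | M w < r] =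
  (\sum_(k < p.+2) 'C(p.+1, k)%:R * ((-1) ^+ k * pospow p (1 - k%:R * r)))%:E.
Hypothesis M2E : forall w, M2 w = M w ^+ 2.

Lemma expectation_max : ('E_Q[M] = (Hsum R 1 p.+1 / p.+1%:R)%:E)%E.
Proof.
rewrite (@ge0_expectation_lincomb R _ _ Q M p.+1
  (fun k => 'C(p.+1, k.+1)%:R * (-1) ^+ k) (fun k => k.+1%:R^-1 / p.+1%:R)
  (fun k r => pospow_strict p (1 - k.+1%:R * r)))//.
- congr EFin; rewrite -alt_bin_sum1 /alt_bin_sum mulr_suml; apply: eq_bigr => k _.
  by rewrite expr1 !mulrA.
- by move=> r r0; exact: ccdf_maxE.
- by move=> k; have [] := integral_pospow_strict R p k.
- by move=> k; have [] := integral_pospow_strict R p k.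
Qed.

Lemma expectation_max2 : ('E_Q[M2] =
  ((Hsum R 1 p.+1 ^+ 2 + Hsum R 2 p.+1) / (p.+1%:R * p.+2%:R))%:E)%E.
Proof.
rewrite (@ge0_expectation_lincomb R _ _ Q M2 p.+1
  (fun k => 'C(p.+1, k.+1)%:R * (-1) ^+ k)
  (fun k => 2 * k.+1%:R ^- 2 / (p.+1%:R * p.+2%:R))
  (fun k r => pospow_strict p (1 - k.+1%:R * Num.sqrt r)))//.
- congr EFin; rewrite -[_ + _](@divfK _ 2)// -alt_bin_sum2 /alt_bin_sum -mulrA mulr_suml.
  by apply: eq_bigr => k _; rewrite !mulrA [_ * 2]mulrAC -!mulrA; congr (_ * _); ring.
- by move=> w; rewrite M2E sqr_ge0.
(* For [r >= 0] the events [M2 > r] and [M > sqrt r] coincide, since [M] is nonnegative. *)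
- move=> r r0; rewrite -(ccdf_maxE M_lt) ?sqrtr_ge0// /ccdf /distribution /pushforward.
  congr (Q _); apply/seteqP; split=> w /=; rewrite !in_itv/= !andbT M2E => h.
    by rewrite -[ltRHS]ger0_norm// -sqrtr_sqr ltr_sqrt// (le_lt_trans r0).
  by rewrite -[ltLHS]sqr_sqrtr// ltr_pXn2r// nnegrE ?sqrtr_ge0.
- by move=> k; have [] := integral_pospow_strict_sqrt R p k.
- by move=> k; have [] := integral_pospow_strict_sqrt R p k.
Qed.
End max_moments.

(** * Gumbel limit *)

(** Dominated convergence for sums whose length grows with [n]: past a fixed [K] the terms of [f n]
    are controlled by the tail of [b], and below [K] finitely many terms converge. *)
Lemma tannery (R : realType) (f : nat -> nat -> R) (g b : nat -> R) (s : R) :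
  (forall k, 0 <= b k) -> cvgn (series b) ->
  (\forall n \near \oo, forall k, `|f n k| <= b k) ->
  (forall k, f n k @[n --> \oo] --> g k) -> series g @ \oo --> s ->
  \sum_(k < n.+1) f n k @[n --> \oo] --> s.
Proof.
move=> b0 cb fb fg gs; apply/cvgrPdist_le => e e0.
have e30 : 0 < e / 3 by rewrite divr_gt0.
have ndb : nondecreasing_seq (series b).
  by apply/nondecreasing_seqP => n; rewrite /series/= big_nat_recr//= lerDl.
have bB n : series b n <= limn (series b) by exact: nondecreasing_cvgn_le.
have [K [Kb Kg]] : exists K, `|limn (series b) - series b K| <= e / 3 /\ `|s - series g K| <= e / 3.
  move/cvgrPdist_le : cb => /(_ _ e30) hb; move/cvgrPdist_le : gs => /(_ _ e30) hg.
  by have [K _ hK] := filterI hb hg; exists K; have [] := hK K (leqnn K).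
have fK : \sum_(k < K) f n k @[n --> \oo] --> \sum_(k < K) g k by apply: cvg_sumr => k.
move/cvgrPdist_le : fK => /(_ _ e30) fK.
near=> n.
have Kn : (K <= n.+1)%N by apply: leqW; near: n; exact: nbhs_infty_ge.
have h1 : `|\sum_(k < K) g k - \sum_(k < K) f n k| <= e / 3 by near: n.
have fbn k : `|f n k| <= b k by move: k; near: n.
have h2 : `|\sum_(k < n.+1) f n k - \sum_(k < K) f n k| <= e / 3.
  rewrite -(big_mkord xpredT (f n)) -(big_mkord xpredT (f n)).
  rewrite (big_cat_nat (leq0n K) Kn)//= [X in X - _]addrC addrK.
  apply: le_trans (ler_norm_sum _ _ _) _.
  apply: (@le_trans _ _ (\sum_(K <= k < n.+1) b k)); first by apply: ler_sum => k _.
  have -> : \sum_(K <= k < n.+1) b k = series b n.+1 - series b K.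
    by rewrite /series/= (big_cat_nat (leq0n K) Kn)//= [X in X - _]addrC addrK.
  apply: le_trans Kb; apply: le_trans (ler_norm _).
  by rewrite lerD2r.
have h3 : `|s - \sum_(k < K) g k| <= e / 3 by rewrite -(big_mkord xpredT g).
move: h1 h2 h3; rewrite !ler_norml.
move: (\sum_(k < K) g k) (\sum_(k < K) f n k) (\sum_(k < n.+1) f n k) => u v w; lra.
Unshelve. all: by end_near. Qed.

Lemma ffact_ratio_cvg (R : realType) (k : nat) :
  ((n ^_ k)%N%:R / n%:R ^+ k : R) @[n --> \oo] --> (1 : R).
Proof.
elim: k => [|k IH].
  by apply: cvg_near_cst; apply: nearW => n; rewrite ffactn0 expr0 divr1.
have : (n ^_ k)%N%:R / n%:R ^+ k * (1 - k%:R * n%:R^-1) @[n --> \oo] --> (1 * (1 - k%:R * 0) : R).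
  apply: cvgM => //; apply: cvgB; first exact: cvg_cst.
  by apply: cvgM; [exact: cvg_cst|exact: cvg_natr_invr].
rewrite mulr0 subr0 mulr1; apply: cvg_trans; apply: near_eq_cvg; near=> n.
have kn : (k < n)%N by near: n; exact: nbhs_infty_gt.
have n0 : n%:R != 0 :> R by rewrite pnatr_eq0 -lt0n (leq_ltn_trans _ kn).
rewrite ffactnSr natrM natrB 1?ltnW// exprS.
by field; rewrite n0 expf_neq0.
Unshelve. all: by end_near. Qed.

Section gumbel.
Context (R : realType) (x : R).
Let r (n : nat) : R := (x + ln n%:R) / n%:R.

Let near_ln_ge (A : R) : \forall n \near \oo, A <= ln n%:R.
Proof.
near=> n; rewrite -[A]expRK ler_ln ?posrE ?expR_gt0//; first by near: n; exact: nbhs_infty_ger.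
by rewrite ltr0n; near: n; exists 1%N.
Unshelve. all: by end_near. Qed.

Let r2_cvg : n%:R * r n ^+ 2 @[n --> \oo] --> (0 : R).
Proof.
apply/cvgrPdist_le => e e0; near=> n.
have n0 : 0 < n%:R :> R by rewrite ltr0n; near: n; exists 1%N.
have : `|x| + 1 <= ln n%:R by near: n; exact: near_ln_ge.
(* From [expR L >= L^3 / 6] and [x + L <= 2 L], it suffices that [4 L^2 <= e L^3 / 6], that is
   [L >= 24 / e]. *)
have : 24 / e <= ln n%:R by near: n; exact: near_ln_ge.
set L := ln n%:R => Le Lx.
have L0 : 0 < L by apply: lt_le_trans Lx; rewrite ltr_wpDl.
have nL : L ^+ 3 / 6 <= n%:R.
  have := expR_ge1Dxn 2 (ltW L0); rewrite lnK ?posrE//.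
  by have -> : 3`! = 6%N by []; move=> /(le_trans _); apply; rewrite lerDr.
have rE : n%:R * r n ^+ 2 = (x + L) ^+ 2 / n%:R.
  by rewrite /r -/L; field; exact: lt0r_neq0.
rewrite sub0r normrN rE ger0_norm; last by rewrite divr_ge0 ?sqr_ge0// ltW.
rewrite ler_pdivrMr//.
apply: (@le_trans _ _ ((2 * L) ^+ 2)).
  rewrite ler_sqr ?nnegrE; last by rewrite mulr_ge0// ltW.
    have := ler_norm x; lra.
  have := ler_norm (- x); rewrite normrN; lra.
apply: (@le_trans _ _ (e * (L ^+ 3 / 6))); last by rewrite ler_wpM2l// ltW.
move: Le; rewrite ler_pdivrMr// => Le.
have -> : e * (L ^+ 3 / 6) = (L * e / 6) * L ^+ 2 by ring.
rewrite exprMn ler_wpM2r ?sqr_ge0// ler_pdivlMr//; lra.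
Unshelve. all: by end_near. Qed.

Let near_r_ge0 : \forall n \near \oo, 0 <= r n.
Proof.
near=> n; rewrite divr_ge0// -lerBlDl sub0r; near: n; exact: near_ln_ge.
Unshelve. all: by end_near. Qed.

(** Since [n * r n ^ 2 = r n * (x + ln n)], it dominates [r n] as soon as [x + ln n >= 1]. *)
Let r_cvg : r n @[n --> \oo] --> (0 : R).
Proof.
apply: (squeeze_cvgr _ (cvg_cst 0) r2_cvg); near=> n.
have -> : 0 <= r n by near: n; exact: near_r_ge0.
have n0 : 0 < n%:R :> R by rewrite ltr0n; near: n; exists 1%N.
have -> : n%:R * r n ^+ 2 = r n * (x + ln n%:R).
  by rewrite /r; field; exact: lt0r_neq0.
rewrite /= ler_peMr//; first by near: n; exact: near_r_ge0.
rewrite -lerBlDl; near: n; exact: near_ln_ge.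
Unshelve. all: by end_near. Qed.

Let nrE n : (0 < n)%N -> n%:R * r n = x + ln n%:R.
Proof. by move=> n0; rewrite /r mulrC divfK// pnatr_eq0 -lt0n. Qed.

Let f (n k : nat) : R := 'C(n, k)%:R * ((-1) ^+ k * pospow_strict n.-1 (1 - k%:R * r n)).

(** Combine [C(n, k) <= n^k / k!] with [1 - k r <= expR (- k r)]: the [k]-th power is that of
    [n * expR (- r (n - 1)) = expR (r - x)], which is at most [expR (1 - x)] once [r <= 1]. The
    majorant is thus an exponential series. *)
Let f_bound : \forall n \near \oo, forall k, `|f n k| <= exp_coeff (expR (1 - x)) k.
Proof.
near=> n => k.
have n0 : (0 < n)%N by near: n; exists 1%N.
have nR0 : 0 < n%:R :> R by rewrite ltr0n.
have r0 : 0 <= r n by near: n; exact: near_r_ge0.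
have r1 : r n <= 1 by near: n; apply: cvgr_le; [exact: r_cvg|exact: ltr01].
have pp : pospow_strict n.-1 (1 - k%:R * r n) <= expR (- r n * n.-1%:R) ^+ k.
  rewrite /pospow_strict; case: ltP => [pos|_]; last by rewrite exprn_ge0// expR_ge0.
  rewrite -expRM_natl [leRHS](_ : _ = expR (- (k%:R * r n)) ^+ n.-1); last first.
    by rewrite -expRM_natl; congr expR; ring.
  by rewrite lerXn2r ?nnegrE ?expR_ge0 ?(ltW pos)//; exact: expR_ge1Dx.
have pp0 : 0 <= pospow_strict n.-1 (1 - k%:R * r n).
  by rewrite /pospow_strict; case: ltP => // /ltW pos; rewrite exprn_ge0.
rewrite /f normrM normrM normrX normrN1 expr1n mul1r !ger0_norm//.
have Cn : 'C(n, k)%:R <= n%:R ^+ k / k`!%:R :> R.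
  by rewrite ler_pdivlMr ?ltr0n ?fact_gt0// -natrM bin_ffact -natrX ler_nat ffact_le_expn.
apply: (le_trans (ler_pM _ pp0 Cn pp)) => //.
rewrite /exp_coeff mulrAC -exprMn ler_pM2r ?invr_gt0 ?ltr0n ?fact_gt0//.
rewrite lerXn2r ?nnegrE ?mulr_ge0 ?expR_ge0//.
rewrite -{1}(lnK (x := n%:R)) ?posrE// -expRD ler_expR.
have -> : n.-1%:R = n%:R - 1 :> R by rewrite -subn1 natrB.
have := nrE n0; lra.
Unshelve. all: by end_near. Qed.

(** With [u = k r], squeeze [1 - u] between [expR (- (u + 2 u^2))] and [expR (- u)]. In the exponent
    [ln n - n r] is exactly [- x]; what remains is [r] and a multiple of [n r^2], both tending to
    0. *)
Let pow_cvg k : n%:R ^+ k * pospow_strict n.-1 (1 - k%:R * r n) @[n --> \oo]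
  --> expR (- x) ^+ k.
Proof.
pose up n : R := expR (k%:R * (- x + r n)).
pose lo n : R := expR (k%:R * (- x + r n - 2 * k%:R * (n%:R * r n ^+ 2))).
have E : expR (- x) ^+ k = expR (k%:R * - x) by rewrite expRM_natl.
have upc : up n @[n --> \oo] --> expR (- x) ^+ k.
  rewrite E -[X in _ --> expR (_ * X)]addr0; apply: (continuous_cvg _ (@continuous_expR _ _)).
  by apply: cvgM; [exact: cvg_cst|apply: cvgD => //; exact: cvg_cst].
have loc : lo n @[n --> \oo] --> expR (- x) ^+ k.
  have -> : expR (- x) ^+ k = expR (k%:R * (- x + 0 - 2 * k%:R * 0)).
    by rewrite E mulr0 addr0 subr0.
  apply: (continuous_cvg _ (@continuous_expR _ _)).
  apply: cvgM; first exact: cvg_cst.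
  apply: cvgB; first by apply: cvgD => //; exact: cvg_cst.
  by apply: cvgM => //; exact: cvg_cst.
have krc : (k%:R * r n : R) @[n --> \oo] --> (0 : R).
  by rewrite -[X in _ --> X](mulr0 k%:R); apply: cvgM => //; exact: cvg_cst.
apply: squeeze_cvgr loc upc; near=> n.
have n0 : (0 < n)%N by near: n; exists 1%N.
have nR0 : 0 < n%:R :> R by rewrite ltr0n.
have r0 : 0 <= r n by near: n; exact: near_r_ge0.
have : k%:R * r n <= 1 / 2 by near: n; apply: cvgr_le krc _ _; rewrite divr_gt0.
set u := k%:R * r n => u1.
have u0 : 0 <= u by rewrite mulr_ge0.
have pE : n.-1%:R = n%:R - 1 :> R by rewrite -subn1 natrB.
have nk : n%:R ^+ k = expR (k%:R * ln n%:R) :> R by rewrite expRM_natl lnK ?posrE.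
have psE : pospow_strict n.-1 (1 - u) = (1 - u) ^+ n.-1.
  by rewrite /pospow_strict ifT//; lra.
(* For [0 <= u <= 1/2], [(1 + u + 2 u^2) (1 - u) = 1 + u^2 (1 - 2 u) >= 1]. *)
have lo1 : expR (- (u + 2 * u ^+ 2)) <= 1 - u.
  rewrite expRN -[leRHS]invrK lef_pV2 ?posrE ?expR_gt0 ?invr_gt0//; last lra.
  apply: le_trans (expR_ge1Dx _).
  rewrite -[leLHS]mul1r ler_pdivrMr; last lra.
  nra.
have nr := nrE n0.
rewrite /lo /up /=.
rewrite -/u psE nk; apply/andP; split.
- apply: (@le_trans _ _ (expR (k%:R * ln n%:R) * expR (- (u + 2 * u ^+ 2)) ^+ n.-1)).
    rewrite -[expR _ ^+ n.-1]expRM_natl -expRD ler_expR pE /u.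
    have -> : ln n%:R = n%:R * r n - x by rewrite nr addrC addKr.
    rewrite -subr_ge0 [leRHS](_ : _ = 2 * (k%:R * r n) ^+ 2); last by ring.
    by rewrite mulr_ge0// sqr_ge0.
  by rewrite ler_wpM2l ?expR_ge0// lerXn2r ?nnegrE ?expR_ge0//; lra.
- apply: (@le_trans _ _ (expR (k%:R * ln n%:R) * expR (- u) ^+ n.-1)).
    rewrite ler_wpM2l ?expR_ge0// lerXn2r ?nnegrE ?expR_ge0//; first lra.
    exact: expR_ge1Dx.
  rewrite -[expR _ ^+ n.-1]expRM_natl -expRD ler_expR pE /u.
  have -> : ln n%:R = n%:R * r n - x by rewrite nr addrC addKr.
  by rewrite -subr_ge0 [leRHS](_ : _ = 0)//; ring.
Unshelve. all: by end_near. Qed.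

Lemma max_cdf_gumbel_cvg :
  \sum_(k < n.+1) 'C(n, k)%:R * ((-1) ^+ k * pospow_strict n.-1 (1 - k%:R * r n))
    @[n --> \oo] --> expR (- expR (- x)).
Proof.
apply: (@tannery R f (exp_coeff (- expR (- x))) (exp_coeff (expR (1 - x)))).
- by move=> k; rewrite exp_coeff_ge0// expR_ge0.
- exact: is_cvg_series_exp_coeff.
- exact: f_bound.
(* Writing [C(n, k)] as a falling factorial over [k!] separates a factor tending to 1 from the one
   treated in [pow_cvg]; the limit is the [k]-th term of the series of [expR (- expR (- x))]. *)
- move=> k; pose c : R := (-1) ^+ k / k`!%:R.
  have h : c * ((n ^_ k)%N%:R / n%:R ^+ k * (n%:R ^+ k * pospow_strict n.-1 (1 - k%:R * r n)))
      @[n --> \oo] --> c * (1 * expR (- x) ^+ k).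
    apply: cvgM; first exact: cvg_cst.
    by apply: cvgM; [exact: ffact_ratio_cvg|exact: pow_cvg].
  have -> : exp_coeff (- expR (- x)) k = c * (1 * expR (- x) ^+ k).
    by rewrite /exp_coeff/= -mulN1r exprMn mul1r /c mulrAC.
  apply: cvg_trans h; apply: near_eq_cvg; near=> n.
  have n0 : n%:R != 0 :> R by rewrite pnatr_eq0 -lt0n; near: n; exists 1%N.
  have k0 : k`!%:R != 0 :> R by rewrite pnatr_eq0 -lt0n fact_gt0.
  rewrite /f -bin_ffact natrM /c; field.
  by rewrite k0 expf_neq0.
- exact: is_cvg_series_exp_coeff.
Unshelve. all: by end_near. Qed.
End gumbel.

(** * Convergence of distribution functions *)

(** A continuous test function lying between the indicators of []-oo, y]] and []-oo, y + e]]. *)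
Definition ramp (R : realType) (y e t : R) : R :=
  Num.min 1 (Num.max 0 (1 - (t - y) / e)).

Section ramp.
Context (R : realType) (y e : R) (e0 : 0 < e).

Lemma ramp_ge0 t : 0 <= ramp y e t.
Proof. by rewrite le_min ler01 le_max lexx. Qed.

Lemma ramp_le1 t : ramp y e t <= 1.
Proof. by rewrite ge_min lexx. Qed.

Lemma ramp_left t : t <= y -> ramp y e t = 1.
Proof.
move=> ty; rewrite /ramp min_l// le_max; apply/orP; right.
by rewrite lerBrDl gerDr pmulr_lle0 ?invr_gt0// subr_le0.
Qed.

Lemma ramp_right t : y + e <= t -> ramp y e t = 0.
Proof.
move=> ty; rewrite /ramp max_l ?min_r// subr_le0 ler_pdivlMr// mul1r.
by rewrite lerBrDl.
Qed.

Lemma continuous_ramp : continuous (ramp y e).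
Proof.
move=> t; apply: (@continuous_min _ _ (cst 1) (fun t => Num.max 0 (1 - (t - y) / e))).
  exact: cvg_cst.
apply: (@continuous_max _ _ (cst 0) (fun t => 1 - (t - y) / e)); first exact: cvg_cst.
apply: cvgB; first exact: cvg_cst.
apply: cvgM; last exact: cvg_cst.
by apply: cvgB; [exact: cvg_id|exact: cvg_cst].
Qed.
End ramp.

Section ramp_expectation.
Context (R : realType) d (T : measurableType d) (P : probability T R) (U : T -> R).
Hypothesis mU : measurable_fun setT U.

Lemma measurable_le_set y : measurable [set w | U w <= y].
Proof.
have := mU measurableT (measurable_itv `]-oo, y]).
by rewrite setTI (_ : _ @^-1` _ = [set w | U w <= y]).
Qed.

Lemma integrable_ramp y e : 0 < e -> P.-integrable setT (EFin \o (ramp y e \o U)).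
Proof.
move=> e0; apply: (@integrable_bounded _ _ _ _ _ 1) => [|w].
  by apply: measurableT_comp => //; apply: continuous_measurable_fun; exact: continuous_ramp.
by rewrite ger0_norm ?ramp_ge0 ?ramp_le1.
Qed.

Lemma probability_le_ramp y e : 0 < e ->
  fine (P [set w | U w <= y]) <= \int[P]_w ramp y e (U w).
Proof.
move=> e0; have mE := measurable_le_set y.
have -> : fine (P [set w | U w <= y]) = \int[P]_w \1_[set w | U w <= y] w.
  by rewrite /Rintegral integral_indic// setIT.
apply: le_Rintegral => //; [exact: integrable_indic|exact: integrable_ramp|].
move=> w _; rewrite indicE; case: (boolP (w \in _)) => [|_]; last exact: ramp_ge0.
by rewrite inE/= => /(ramp_left e0) ->.
Qed.

Lemma ramp_le_probability y e : 0 < e ->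
  \int[P]_w ramp y e (U w) <= fine (P [set w | U w <= y + e]).
Proof.
move=> e0; have mE := measurable_le_set (y + e).
have -> : fine (P [set w | U w <= y + e]) = \int[P]_w \1_[set w | U w <= y + e] w.
  by rewrite /Rintegral integral_indic// setIT.
apply: le_Rintegral => //; [exact: integrable_ramp|exact: integrable_indic|].
move=> w _; rewrite indicE; case: (boolP (w \in _)) => [_|]; first exact: ramp_le1.
by rewrite notin_setE/= => /negP; rewrite -ltNge => /ltW /(ramp_right e0) ->.
Qed.

Lemma probability_le_right y (eta : R) : 0 < eta ->
  exists2 e : R, 0 < e & fine (P [set w | U w <= y + e]) <= fine (P [set w | U w <= y]) + eta.
Proof.
move=> eta0; pose F (j : nat) := [set w | U w <= y + j.+1%:R^-1].
have FE : \bigcap_j F j = [set w | U w <= y].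
  apply/seteqP; split=> w /=.
    move=> h; apply/ler_addgt0Pr => e e0.
    have je : (Num.truncn e^-1).+1%:R^-1 <= e.
      by rewrite invf_ple ?posrE// ltW// truncnS_gt.
    by apply: le_trans (h (Num.truncn e^-1) I) _; rewrite lerD2l.
  by move=> h j _; apply: le_trans h _; rewrite lerDl invr_ge0.
have : P (F j) @[j --> \oo] --> P (\bigcap_j F j).
  apply: nonincreasing_cvg_mu.
  - by rewrite -ge0_fin_numE// fin_num_measure//; exact: measurable_le_set.
  - by move=> j; exact: measurable_le_set.
  - by rewrite FE; exact: measurable_le_set.
  - apply/nonincreasing_seqP => j; apply/subsetPset => w /= /le_trans; apply.
    by rewrite lerD2l lef_pV2 ?posrE// ler_nat.
rewrite FE -[X in _ --> X -> _](fineK (fin_num_measure P _ (measurable_le_set y))) => /fine_cvg.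
move=> /cvgrPdist_le /(_ _ eta0) [j _ hj].
exists (j.+1%:R^-1); first by rewrite invr_gt0.
have := hj j (leqnn j); rewrite /= ler_norml => /andP[h _].
by move: h; rewrite /F; move: (fine _) (fine _) => a b; lra.
Qed.

(** Continuity from below only reaches the event [U < y]; the absence of an atom at [y] turns it
    into [U <= y]. *)
Lemma probability_le_left y (eta : R) : 0 < eta -> P (U @^-1` [set y]) = 0%E ->
  exists2 e : R, 0 < e & fine (P [set w | U w <= y]) - eta <= fine (P [set w | U w <= y - e]).
Proof.
move=> eta0 atom; pose F (j : nat) := [set w | U w <= y - j.+1%:R^-1].
have FE : \bigcup_j F j = [set w | U w < y].
  apply/seteqP; split=> w /=.
    by move=> [j _ /le_lt_trans]; apply; rewrite ltrBlDr ltrDl invr_gt0.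
  rewrite -subr_gt0 => h; exists (Num.truncn (y - U w)^-1) => //.
  rewrite /F /= lerBrDr -lerBrDl invf_ple ?posrE//.
  by rewrite ltW// truncnS_gt.
have mlt : measurable [set w | U w < y].
  by rewrite -FE; apply: bigcup_measurable => j _; exact: measurable_le_set.
have m1 : measurable (U @^-1` [set y]) by rewrite -[_ @^-1` _]setTI; exact: mU.
have PE : P [set w | U w < y] = P [set w | U w <= y].
  rewrite -[LHS]adde0 -atom -measureU//; last first.
    by apply/seteqP; split=> // w /= [+ Uy]; rewrite Uy ltxx.
  congr (P _); apply/seteqP; split=> w /=; first by case=> [/ltW//|->].
  by rewrite le_eqVlt => /orP[/eqP|]; [right|left].
have : P (F j) @[j --> \oo] --> P (\bigcup_j F j).
  apply: nondecreasing_cvg_mu.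
  - by move=> j; exact: measurable_le_set.
  - by rewrite FE.
  - apply/nondecreasing_seqP => j; apply/subsetPset => w /= /le_trans; apply.
    by rewrite lerD2l lerN2 lef_pV2 ?posrE// ler_nat.
rewrite FE PE -[X in _ --> X -> _](fineK (fin_num_measure P _ (measurable_le_set y))) => /fine_cvg.
move=> /cvgrPdist_le /(_ _ eta0) [j _ hj].
exists (j.+1%:R^-1); first by rewrite invr_gt0.
have := hj j (leqnn j); rewrite /= ler_norml => /andP[_ h].
by move: h; rewrite /F; move: (fine _) (fine _) => a b; lra.
Qed.
End ramp_expectation.

(** One direction of the portmanteau theorem: the ramp starting at [y] bounds the probability from
    above and the one ending at [y] bounds it from below. Half of [eta] pays for the width of the
    ramp, half for the convergence of its integral. *)
Lemma cvg_cdf_of_cvg_expectation (R : realType)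
    (d : nat -> measure_display) (T : forall m, measurableType (d m))
    (P : forall m, probability (T m) R) (U : forall m, T m -> R)
    d' (S : measurableType d') (Q : probability S R) (M : S -> R) (y : R) :
  (forall m, measurable_fun setT (@U m)) -> measurable_fun setT M ->
  (forall phi : R -> R, continuous phi -> (forall t, `|phi t| <= 1) ->
    ('E_(P m)[phi \o @U m] @[m --> \oo] --> 'E_Q[phi \o M])%E) ->
  Q (M @^-1` [set y]) = 0%E ->
  P m [set w | @U m w <= y] @[m --> \oo] --> Q [set w | M w <= y].
Proof.
move=> mU mM UM atom.
have UMr z e : 0 < e ->
    \int[P m]_w ramp z e (@U m w) @[m --> \oo] --> \int[Q]_w ramp z e (M w).
  move=> e0; have := UM (ramp z e); rewrite expectation_Rintegral; last exact: integrable_ramp.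
  under eq_cvg do rewrite (expectation_Rintegral (integrable_ramp _ _ _ e0))//.
  have b1 t : `|ramp z e t| <= 1 by rewrite ger0_norm ?ramp_ge0 ?ramp_le1.
  by move=> /(_ (@continuous_ramp R z e) b1) /fine_cvg.
rewrite -(fineK (fin_num_measure Q _ (measurable_le_set mM y))).
apply: cvg_EFin; first by apply: nearW => m; rewrite fin_num_measure//; exact: measurable_le_set.
apply/cvgrPdist_le => eta eta0; have eta20 : 0 < eta / 2 by rewrite divr_gt0.
have [e1 e10 h1] := probability_le_right Q mM y eta20.
have [e2 e20 h2] := probability_le_left mM eta20 atom.
have /cvgrPdist_le/(_ _ eta20) c1 := UMr y e1 e10.
have /cvgrPdist_le/(_ _ eta20) c2 := UMr (y - e2) e2 e20.
near=> m.
have c1' : `|\int[Q]_w ramp y e1 (M w) - \int[P m]_w ramp y e1 (@U m w)| <= eta / 2 by near: m.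
have c2' : `|\int[Q]_w ramp (y - e2) e2 (M w) - \int[P m]_w ramp (y - e2) e2 (@U m w)| <= eta / 2.
  by near: m.
have p1 := probability_le_ramp (P m) (mU m) y e10.
have p2 := ramp_le_probability (P m) (mU m) (y - e2) e20.
have q1 := ramp_le_probability Q mM y e10.
have q2 := probability_le_ramp Q mM (y - e2) e20.
rewrite subrK in p2.
move: c1' c2'; rewrite !ler_norml /=.
move: (\int[Q]_w _) (\int[Q]_w _) (\int[P m]_w _) (\int[P m]_w _) p1 p2 q1 q2 h1 h2.
move: (fine _) (fine _) (fine _) (fine _) => a b c d0 e f g h; lra.
Unshelve. all: by end_near. Qed.

(** * The maximum of a uniform point of the simplex: moments, distribution function, atoms *)

Section uniform_simplex_max.
Context (R : realType) (p : nat) d (S : measurableType d) (Q : probability S R)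
  (X : {RV Q >-> p.+1.-tuple R}).
Hypothesis X_uniform : uniform_on_simplex Q X.

Lemma measurable_simplex_coord i : measurable_fun setT (fun w => rV_of_tuple (X w) 0 i).
Proof.
under eq_fun do rewrite mxE.
exact: (measurableT_comp (measurable_tnth i)).
Qed.

Lemma simplex_orthant (a : 'I_p.+1 -> R) : (forall i, 0 <= a i) ->
  Q ((fun w => rV_of_tuple (X w)) @^-1` orthant a) = (pospow p (1 - \sum_i a i))%:E.
Proof.
move=> a0; rewrite -(simplex_survival X_uniform a0); congr (Q _).
by apply/seteqP; split=> w /= h i; have := h i; rewrite mxE.
Qed.

Lemma row_max_rV_of_tuple (x : p.+1.-tuple R) : row_max (rV_of_tuple x) = tuple_max x.
Proof. by apply: eq_bigr => i _; rewrite mxE. Qed.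

Lemma measurable_tuple_max : measurable_fun setT (fun w => tuple_max (X w)).
Proof.
under eq_fun do rewrite -row_max_rV_of_tuple.
exact: measurable_row_max measurable_simplex_coord.
Qed.

Lemma tuple_max_ge0 w : 0 <= tuple_max (X w).
Proof. exact: bigmax_ge_id. Qed.

Let M : {RV Q >-> R} :=
  HB.pack (fun w => tuple_max (X w)) (isMeasurableFun.Build _ _ _ _ _ measurable_tuple_max).

Let M2 : {RV Q >-> R} :=
  HB.pack (fun w => tuple_max (X w) ^+ 2)
    (isMeasurableFun.Build _ _ _ _ _ (measurable_funX 2 measurable_tuple_max)).

Let M_lt r : 0 < r -> Q [set w | M w < r] =
  (\sum_(k < p.+2) 'C(p.+1, k)%:R * ((-1) ^+ k * pospow p (1 - k%:R * r)))%:E.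
Proof.
move=> r0; rewrite -(probability_row_max_lt measurable_simplex_coord simplex_orthant r0).
by congr (Q _); apply/seteqP; split=> w /=; rewrite row_max_rV_of_tuple.
Qed.

Lemma expectation_tuple_max :
  ('E_Q[fun w => tuple_max (X w)] = (Hsum R 1 p.+1 / p.+1%:R)%:E)%E.
Proof. exact: (expectation_max (M := M) tuple_max_ge0 M_lt). Qed.

Lemma expectation_tuple_max2 :
  ('E_Q[fun w => (tuple_max (X w) ^+ 2)%R] =
   ((Hsum R 1 p.+1 ^+ 2 + Hsum R 2 p.+1) / (p.+1%:R * p.+2%:R))%:E)%E.
Proof. exact: (expectation_max2 (M := M) (M2 := M2) tuple_max_ge0 M_lt). Qed.

Lemma tuple_max_cdfE r : 0 <= r -> Q [set w | tuple_max (X w) <= r] =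
  (\sum_(k < p.+2) 'C(p.+1, k)%:R * ((-1) ^+ k * pospow_strict p (1 - k%:R * r)))%:E.
Proof.
move=> r0; rewrite -(cdf_maxE M_lt r0) /cdf /distribution /pushforward.
by congr (Q _); apply/seteqP; split=> w /=; rewrite in_itv.
Qed.

(** For [r > 0] an atom would separate the formulas for [tuple_max < r] and [tuple_max <= r], which
    differ only through [pospow] and [pospow_strict]. The excluded case is the Dirac mass at 1 for
    one queue. *)
Lemma tuple_max_no_atom r : (p = 0%N -> r != 1) ->
  Q ((fun w => tuple_max (X w)) @^-1` [set r]) = 0%E.
Proof.
move=> r1; have mM := measurable_tuple_max.
have mle (t : R) : measurable [set w | tuple_max (X w) <= t] by exact: measurable_le_set.
have m1 : measurable ((fun w => tuple_max (X w)) @^-1` [set r]).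
  by rewrite -[_ @^-1` _]setTI; exact: mM.
have [r0|r0|r0] := ltgtP r 0.
- rewrite (_ : _ @^-1` _ = set0) ?measure0//; apply/seteqP; split=> w //= wr.
  by have := tuple_max_ge0 w; rewrite wr leNgt r0.
- have eqlt : Q [set w | tuple_max (X w) < r] = Q [set w | tuple_max (X w) <= r].
    rewrite (M_lt r0) (tuple_max_cdfE (ltW r0)); congr EFin; apply: eq_bigr => k _.
    congr (_ * (_ * _)); rewrite /pospow /pospow_strict le_eqVlt.
    have [e|] := eqVneq 0 (1 - k%:R * r); last by [].
    (* At argument 0 the two versions agree unless [p = 0]. Then [k] is 0, which makes the argument
       1, or 1, which forces [r = 1]. *)
    rewrite -e ltxx /= expr0n; case: p r1 k e => [|//] r1 [[|[|//]] /= _] /eqP.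
      by rewrite mul0r subr0 eq_sym oner_eq0.
    by rewrite mul1r eq_sym subr_eq0 eq_sym => e; move: (r1 erefl); rewrite e.
  have mlt : measurable [set w | tuple_max (X w) < r].
    have := mM measurableT _ (measurable_itv `]-oo, r[).
    by rewrite setTI (_ : _ @^-1` _ = [set w | tuple_max (X w) < r]).
  have : Q [set w | tuple_max (X w) <= r] =
      (Q [set w | (tuple_max (X w) < r)%R] + Q ((fun w => tuple_max (X w)) @^-1` [set r]))%E.
    rewrite -measureU//; last by apply/seteqP; split=> // w /= [+ wr]; rewrite wr ltxx.
    congr (Q _); apply/seteqP; split=> w /=.
      by rewrite le_eqVlt => /orP[/eqP|]; [right|left].
    by case=> [/ltW//|->].
  rewrite eqlt => /(congr1 (fun z => z - Q [set w | (tuple_max (X w) <= r)%R])%E).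
  by rewrite addeAC subee ?add0e ?fin_num_measure.
- apply/eqP; rewrite -measure_le0 r0.
  apply: (@le_trans _ _ (Q [set w | tuple_max (X w) <= 0])).
    apply: le_measure; rewrite ?inE//; first by rewrite -r0.
    by move=> w /= ->.
  (* At [r = 0] every power is 1 and the formula reduces to the alternating sum of binomial
     coefficients. *)
  rewrite tuple_max_cdfE// lee_fin.
  rewrite [leLHS](_ : _ = 0)// -[RHS](sum_alt_bin R (ltn0Sn p)).
  by apply: eq_bigr => k _; rewrite mulr0 subr0 /pospow_strict ltr01 expr1n mulr1.
Qed.
End uniform_simplex_max.

(** * Maximal queue length *)

Lemma row_max_scaled (R : realType) n m (c : R) (l : state n m) : 0 <= c ->
  row_max (c *: qlen_rV R l) = c * (qmax l)%:R.
Proof.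
move=> c0; rewrite /row_max /qmax.
rewrite (big_morph (fun k => c * k%:R) (id1 := 0) (op1 := Num.max)); last 2 first.
- move=> a b; have [ab|/ltnW ba] := leqP a b.
    by rewrite max_r// ler_wpM2l// ler_nat.
  by rewrite max_l// ler_wpM2l// ler_nat.
- by rewrite mulr0.
by apply: eq_bigr => i _; rewrite !mxE.
Qed.

Lemma qlen_le n m (l : state n m) i : (qlen l i <= m)%N.
Proof. by rewrite -ltnS ltn_ord. Qed.

Lemma qmax_le n m (l : state n m) : (qmax l <= m)%N.
Proof. by apply/bigmax_leqP => i _; exact: qlen_le. Qed.

Section fixed_dimension.
Context (R : realType) (p : nat) (kappa : nat -> R) (kbar : R).
Hypothesis kappa_gt0 : forall m, 0 < kappa m.
Hypothesis kappa_cvg : kappa m / m%:R @[m --> \oo] --> kbar.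
Hypothesis kbar_lt1 : kbar < 1.
Context (d : nat -> measure_display) (T : forall m, measurableType (d m))
  (P : forall m, probability (T m) R) (L : forall m, T m -> state p.+1 m).
Hypothesis mL : forall m l, measurable (@L m @^-1` [set l]).
Hypothesis pmfL : forall m l,
  fine (P m (@L m @^-1` [set l])) = stationary_pmf (kappa m) l.
Context d' (S : measurableType d') (Q : probability S R)
  (X : {RV Q >-> p.+1.-tuple R}).
Hypothesis X_uniform : uniform_on_simplex Q X.

Let Y m (w : T m) : 'rV[R]_p.+1 := (m%:R - kappa m)^-1 *: qlen_rV R (L w).

Let Z w : 'rV[R]_p.+1 := rV_of_tuple (X w).

(** One bound for both sides: [(1 - kbar)^-1] is the limit of [m / (m - kappa)], which bounds the
    scaled queue lengths, and 2 is the almost sure bound of [ae_le2]; each summand also provides the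
    slack for the other. *)
Let B : R := (1 - kbar)^-1 + 2.

Let kb0 : 0 < (1 - kbar)^-1.
Proof. by rewrite invr_gt0 subr_gt0. Qed.

Lemma measurable_of_states m (g : state p.+1 m -> R) : measurable_fun setT (fun w => g (@L m w)).
Proof.
move=> _ A mA; rewrite setTI.
exact: (measurable_finite_preimage (@mL m) (g @^-1` A)).
Qed.

Let near_scale : \forall m \near \oo, m%:R / (m%:R - kappa m) <= B.
Proof.
have h : ((m%:R - kappa m) / m%:R)^-1 @[m --> \oo] --> (1 - kbar)^-1.
  apply: cvgV; last exact: cvg_scaled_gap.
  by rewrite lt0r_neq0// subr_gt0.
near=> m; rewrite -invf_div; near: m; apply: cvgr_le h _ _.
by rewrite /B ltrDl.
Unshelve. all: by end_near. Qed.

Let near_gap : \forall m \near \oo, 0 < m%:R - kappa m.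
Proof. by have := near_gap_gt0 kappa_cvg kbar_lt1; apply: filterS => m; rewrite subr_gt0. Qed.

Let near_box : \forall m \near \oo, forall (w : T m) i, 0 <= Y w 0 i <= B.
Proof.
near=> m => w i; rewrite !mxE.
have D0 : 0 < m%:R - kappa m by near: m; exact: near_gap.
rewrite mulr_ge0 ?invr_ge0 ?(ltW D0)//=.
apply: (@le_trans _ _ (m%:R / (m%:R - kappa m))); last by near: m; exact: near_scale.
by rewrite mulrC ler_wpM2r ?invr_ge0 ?(ltW D0)// ler_nat qlen_le.
Unshelve. all: by end_near. Qed.

Lemma queue_cvg_in_distribution : cvg_in_distribution P Y Q Z.
Proof.
apply: (@cvg_in_distribution_orthant _ _ _ _ _ _ _ _ _ _ B).
- by move=> m i; exact: (measurable_of_states (fun l => ((m%:R - kappa m)^-1 *: qlen_rV R l) 0 i)).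
- by move=> i; exact: measurable_simplex_coord.
- exact: near_box.
- have := ae_box (@measurable_simplex_coord _ _ _ _ _ X) (simplex_orthant X_uniform).
  apply: filterS => w h i; have /andP[-> h2] := h i; apply: le_trans h2 _.
  by rewrite /B lerDr ltW.
move=> a a0 a1; rewrite (simplex_orthant X_uniform a0).
have := queue_survival_cvg kappa_gt0 kappa_cvg kbar_lt1 mL pmfL a0 a1.
apply: cvg_trans; apply: near_eq_cvg; apply: nearW => m; congr (P m _).
by apply/seteqP; split=> w /= h i; have := h i; rewrite !mxE.
Qed.

Lemma row_max_cvg_expectation (phi : R -> R) (C : R) : continuous phi ->
  (forall t, `|phi t| <= C) ->
  ('E_(P m)[fun w => phi (row_max (@Y m w))] @[m --> \oo]
   --> 'E_Q[fun w => phi (tuple_max (X w))])%E.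
Proof.
move=> cphi phiC.
have := @queue_cvg_in_distribution (phi \o @row_max R p.+1) _ _.
rewrite (_ : (phi \o @row_max R p.+1) \o Z = (fun w => phi (tuple_max (X w)))); last first.
  by apply/funext => w /=; rewrite row_max_rV_of_tuple.
apply; last by exists C => y; exact: phiC.
move=> y; apply: continuous_comp; first exact: continuous_row_max.
exact: cphi.
Qed.

(** Powers are unbounded, so [phi] clips its argument to [[0, B]] first. It coincides with the power
    on the scaled maximum for large [m], and almost surely on the maximum of [X]. *)
Lemma queue_max_moment_cvg (k : nat) :
  ('E_(P m)[fun w => (((m%:R - kappa m)^-1 * (qmax (@L m w))%:R) ^+ k)%R] @[m --> \oo]
   --> 'E_Q[fun w => (tuple_max (X w) ^+ k)%R])%E.
Proof.
have B0 : 0 <= B by rewrite /B addr_ge0// ltW.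
pose phi (t : R) := (Num.min B (Num.max 0 t)) ^+ k.
have cmin : continuous (fun t : R => Num.min B (Num.max 0 t)).
  move=> t; apply: (@continuous_min R R (cst B) (fun t : R => Num.max 0 t) t); first exact: cvg_cst.
  by apply: (@continuous_max R R (cst 0) id t); [exact: cvg_cst|exact: cvg_id].
have cphi : continuous phi.
  move=> t; apply: (@continuous_comp R R R _ (fun t => t ^+ k) t (cmin t)).
  exact: exprn_continuous.
have phiB t : `|phi t| <= B ^+ k.
  have h0 : 0 <= Num.min B (Num.max 0 t) by rewrite le_min B0 le_max lexx.
  rewrite /phi ger0_norm ?exprn_ge0// lerXn2r ?nnegrE//.
  by rewrite ge_min lexx.
have phiE t : 0 <= t -> t <= B -> phi t = t ^+ k.
  by move=> t0 tB; rewrite /phi max_r// min_r.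
have := row_max_cvg_expectation cphi phiB.
have -> : ('E_Q[fun w => phi (tuple_max (X w))] = 'E_Q[fun w => (tuple_max (X w) ^+ k)%R])%E.
  have mM := measurable_tuple_max X.
  rewrite unlock; apply: ae_eq_integral => //.
  - apply/measurable_EFinP; apply: measurableT_comp => //.
    exact: continuous_measurable_fun.
  - by apply/measurable_EFinP; exact: measurable_funX.
  - have := ae_box (@measurable_simplex_coord _ _ _ _ _ X) (simplex_orthant X_uniform).
    apply: filterS => w h _; congr EFin; apply: phiE; first exact: tuple_max_ge0.
    rewrite -row_max_rV_of_tuple; apply: row_max_le => // i.
    by have /andP[_ h2] := h i; apply: le_trans h2 _; rewrite /B lerDr ltW.
apply: cvg_trans; apply: near_eq_cvg; near=> m.
have D0 : 0 < m%:R - kappa m by near: m; exact: near_gap.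
have YB : forall (w : T m) i, 0 <= Y w 0 i <= B by near: m; exact: near_box.
congr ('E_(_)[_])%E; apply/funext => w.
rewrite -row_max_scaled ?invr_ge0 ?(ltW D0)// phiE//; first exact: row_max_ge0.
by apply: row_max_le => // i; have /andP[] := YB w i.
Unshelve. all: by end_near. Qed.

Let A k m : R := \int[P m]_w ((qmax (@L m w))%:R ^+ k).

Let c m : R := (m%:R - kappa m)^-1.

Let integrable_qmax k m :
  (P m).-integrable setT (EFin \o (fun w => (qmax (@L m w))%:R ^+ k)).
Proof.
apply: (@integrable_bounded _ _ _ _ _ (m%:R ^+ k)).
  exact: (measurable_of_states (fun l => (qmax l)%:R ^+ k)).
move=> w; rewrite ger0_norm ?exprn_ge0// lerXn2r ?nnegrE//.
by rewrite ler_nat qmax_le.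
Qed.

Let scaled_moment_cvg k (mu : R) :
  ('E_Q[fun w => (tuple_max (X w) ^+ k)%R] = mu%:E)%E ->
  c m ^+ k * A k m @[m --> \oo] --> mu.
Proof.
move=> muE; have := @queue_max_moment_cvg k; rewrite muE.
have E m : ('E_(P m)[fun w => (((m%:R - kappa m)^-1 * (qmax (@L m w))%:R) ^+ k)%R] =
    (c m ^+ k * A k m)%:E)%E.
  have -> : c m ^+ k * A k m = \int[P m]_w (c m ^+ k * (qmax (@L m w))%:R ^+ k).
    by rewrite RintegralZl//; exact: integrable_qmax.
  rewrite -expectation_Rintegral; last exact: (integrableZl _ (c m ^+ k) (integrable_qmax k m)).
  by congr ('E_(_)[_])%E; apply/funext => w; rewrite exprMn.
by under eq_cvg do rewrite E; move=> /fine_cvg.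
Qed.

Let mean_cvg : c m * A 1 m @[m --> \oo] --> Hsum R 1 p.+1 / p.+1%:R.
Proof.
have := @scaled_moment_cvg 1 _ _; apply.
rewrite -(expectation_tuple_max X_uniform).
by congr ('E_(_)[_])%E; apply/funext => w; rewrite expr1.
Qed.

Lemma queue_max_mean_cvg :
  ((p.+1%:R / (m%:R - kappa m))%R%:E * 'E_(P m)[fun w => (qmax (@L m w))%:R%R] @[m --> \oo]
   --> (Hsum R 1 p.+1)%:E)%E.
Proof.
have E m : ((p.+1%:R / (m%:R - kappa m))%R%:E * 'E_(P m)[fun w => (qmax (@L m w))%:R%R] =
    (p.+1%:R * (c m * A 1 m))%:E)%E.
  rewrite expectation_Rintegral; last exact: (integrable_qmax 1 m).
  by rewrite -EFinM -mulrA.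
under eq_cvg do rewrite E.
apply: cvg_EFin; first exact: nearW.
have -> : Hsum R 1 p.+1 = p.+1%:R * (Hsum R 1 p.+1 / p.+1%:R).
  by rewrite mulrC divfK// pnatr_eq0.
by apply: cvgM; [exact: cvg_cst|exact: mean_cvg].
Qed.

Lemma queue_max_variance_cvg :
  ((p.+1%:R ^+ 2 / (m%:R - kappa m) ^+ 2)%R%:E * 'V_(P m)[fun w => (qmax (@L m w))%:R%R]
     @[m --> \oo]
   --> ((p.+1%:R * Hsum R 2 p.+1 - Hsum R 1 p.+1 ^+ 2) / (p.+1%:R + 1))%R%:E)%E.
Proof.
have E m : ((p.+1%:R ^+ 2 / (m%:R - kappa m) ^+ 2)%R%:E *
      'V_(P m)[fun w => (qmax (@L m w))%:R%R] =
    (p.+1%:R ^+ 2 * (c m ^+ 2 * A 2 m - (c m * A 1 m) ^+ 2))%:E)%E.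
  have i1 := integrable_qmax 1 m; have i2 := integrable_qmax 2 m.
  rewrite /variance covarianceE; last 3 first.
  - exact/Lfun1_integrable.
  - exact/Lfun1_integrable.
  - exact/Lfun1_integrable.
  rewrite (expectation_Rintegral i2) (expectation_Rintegral i1).
  rewrite -[X in (_ - X)%E]EFinM -EFinB -EFinM.
  congr EFin; rewrite -/(A 1 m) -/(A 2 m) /c -exprVn; ring.
under eq_cvg do rewrite E.
apply: cvg_EFin; first exact: nearW.
(* With [n = p.+1] the right-hand side is [n (H_1^2 + H_2) / (n + 1) - H_1^2], the scaled limit of
   the second moment minus that of the squared mean. *)
have -> : (p.+1%:R * Hsum R 2 p.+1 - Hsum R 1 p.+1 ^+ 2) / (p.+1%:R + 1) =
  p.+1%:R ^+ 2 * ((Hsum R 1 p.+1 ^+ 2 + Hsum R 2 p.+1) / (p.+1%:R * p.+2%:R) -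
    (Hsum R 1 p.+1 / p.+1%:R) ^+ 2) :> R.
  rewrite -[p.+2%:R]natr1; field.
  by rewrite !nat1r natr1 !pnatr_eq0.
apply: cvgM; first exact: cvg_cst.
apply: cvgB; first exact: scaled_moment_cvg (expectation_tuple_max2 X_uniform).
by rewrite !expr2; apply: cvgM; exact: mean_cvg.
Qed.

Lemma queue_max_cdf_cvg (x : R) : (p.+1 = 1%N -> x != 1) ->
  P m [set w | p.+1%:R / (m%:R - kappa m) * (qmax (@L m w))%:R <= x + ln p.+1%:R] @[m --> \oo]
  --> Q [set w | p.+1%:R * tuple_max (X w) <= x + ln p.+1%:R].
Proof.
move=> x1; pose y : R := (x + ln p.+1%:R) / p.+1%:R.
have n0 : 0 < p.+1%:R :> R by rewrite ltr0n.
have leE t : (p.+1%:R * t <= x + ln p.+1%:R) = (t <= y).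
  by rewrite /y ler_pdivlMr// mulrC.
have -> : [set w | p.+1%:R * tuple_max (X w) <= x + ln p.+1%:R] = [set w | tuple_max (X w) <= y].
  by apply/seteqP; split=> w /=; rewrite leE.
have : P m [set w | row_max (@Y m w) <= y] @[m --> \oo] --> Q [set w | tuple_max (X w) <= y].
  apply: cvg_cdf_of_cvg_expectation.
  - move=> m.
    exact: (measurable_of_states (fun l => row_max ((m%:R - kappa m)^-1 *: qlen_rV R l))).
  - exact: measurable_tuple_max.
  - by move=> phi cphi phi1; exact: row_max_cvg_expectation cphi phi1.
  (* For a single queue [ln 1 = 0], so [y = x], and the excluded [x = 1] is the location of the
     atom. *)
  - apply: tuple_max_no_atom => // p0; rewrite /y p0 ln1 addr0 divr1.
    by apply: x1; rewrite p0.
apply: cvg_trans; apply: near_eq_cvg; near=> m.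
have D0 : 0 < m%:R - kappa m by near: m; exact: near_gap.
congr (P m _); apply/seteqP; split=> w /=;
  by rewrite row_max_scaled ?invr_ge0 ?(ltW D0)// -leE mulrA.
Unshelve. all: by end_near. Qed.
End fixed_dimension.

Theorem theorem2 (R : realType)
    (kappa : nat -> R) (kbar : R)
    (kappa_gt0 : forall m, 0 < kappa m)
    (kappa_cvg : kappa m / m%:R @[m --> \oo] --> kbar)
    (kbar_lt1 : kbar < 1)
    (lam : nat -> nat -> R) (p mu : forall n : nat, nat -> 'I_n -> R)
    (network : forall n m, (0 < n)%N ->
       homogeneous_network (lam n m) (p n m) (mu n m) (kappa m))
    (d : nat -> nat -> measure_display)
    (T : forall n m, measurableType (d n m))
    (P : forall n m, probability (T n m) R)
    (L : forall n m, T n m -> state n m)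
    (L_stationary : forall n m, (0 < n)%N ->
       stationary_queue_lengths (lam n m) (p n m) (mu n m) (P n m) (L n m))
    (d' : nat -> measure_display)
    (S : forall n, measurableType (d' n))
    (Q : forall n, probability (S n) R)
    (X : forall n, {RV (Q n) >-> n.-tuple R})
    (X_uniform : forall n, (0 < n)%N -> uniform_on_simplex (Q n) (X n)) :
  (forall n, (0 < n)%N ->
    [/\ cvg_in_distribution (P n)
          (fun m (w : T n m) => (m%:R - kappa m)^-1 *: qlen_rV R (L n m w))
          (Q n) (fun w => rV_of_tuple (X n w)),
        forall k : nat,
          ('E_(P n m)[fun w =>
              (((m%:R - kappa m)^-1 * (qmax (L n m w))%:R) ^+ k)%R]
             @[m --> \oo]
           --> 'E_(Q n)[fun w => (tuple_max (X n w) ^+ k)%R])%E,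
        ((n%:R / (m%:R - kappa m))%R%:E
            * 'E_(P n m)[fun w => (qmax (L n m w))%:R%R] @[m --> \oo]
         --> (Hsum R 1 n)%:E)%E,
        ((n%:R ^+ 2 / (m%:R - kappa m) ^+ 2)%R%:E
            * 'V_(P n m)[fun w => (qmax (L n m w))%:R%R] @[m --> \oo]
         --> ((n%:R * Hsum R 2 n - Hsum R 1 n ^+ 2) / (n%:R + 1))%R%:E)%E &
        forall x : R, (n = 1%N -> x != 1) ->
          P n m [set w | n%:R / (m%:R - kappa m) * (qmax (L n m w))%:R
                         <= x + ln n%:R] @[m --> \oo]
          --> Q n [set w | n%:R * tuple_max (X n w) <= x + ln n%:R]])
  /\
  (forall x : R,
    Q n [set w | n%:R * tuple_max (X n w) <= x + ln n%:R] @[n --> \oo]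
    --> (expR (- expR (- x)))%:E).
Proof.
(* Uniqueness of the stationary distribution identifies the law of [L] with the explicit weights. *)
have pmf n m l : fine (P n.+1 m (L n.+1 m @^-1` [set l])) = stationary_pmf (kappa m) l.
  have [_ st] := @L_stationary n.+1 m isT.
  exact: (stationary_distributionE _ (kappa_gt0 m) (network n.+1 m isT)).1 st l.
have mL n m l : measurable (L n.+1 m @^-1` [set l]).
  by have [h _] := @L_stationary n.+1 m isT; exact: h.
have XU n := @X_uniform n.+1 isT.
split.
  case=> [//|n] _; split.
  - exact: (queue_cvg_in_distribution kappa_gt0 kappa_cvg kbar_lt1 (@mL n) (@pmf n) (XU n)).
  - exact: (queue_max_moment_cvg kappa_gt0 kappa_cvg kbar_lt1 (@mL n) (@pmf n) (XU n)).
  - exact: (queue_max_mean_cvg kappa_gt0 kappa_cvg kbar_lt1 (@mL n) (@pmf n) (XU n)).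
  - exact: (queue_max_variance_cvg kappa_gt0 kappa_cvg kbar_lt1 (@mL n) (@pmf n) (XU n)).
  - exact: (queue_max_cdf_cvg kappa_gt0 kappa_cvg kbar_lt1 (@mL n) (@pmf n) (XU n)).
move=> x.
pose F n : R := \sum_(k < n.+1) 'C(n, k)%:R *
  ((-1) ^+ k * pospow_strict n.-1 (1 - k%:R * ((x + ln n%:R) / n%:R))).
(* The closed form holds at nonnegative arguments only; [x + ln n] is nonnegative once
   [n >= expR (- x)]. *)
have QE n : (0 < n)%N -> 0 <= (x + ln n%:R) / n%:R ->
    (F n)%:E = Q n [set w | n%:R * tuple_max (X n w) <= x + ln n%:R].
  case: n => [//|n] _ r0; rewrite -(tuple_max_cdfE (XU n) r0); congr (Q _ _).
  by apply/seteqP; split=> w /=; rewrite ler_pdivlMr ?ltr0n// mulrC.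
suff : (F n)%:E @[n --> \oo] --> (expR (- expR (- x)))%:E.
  apply: cvg_trans; apply: near_eq_cvg; near=> n.
  have n0 : (0 < n)%N by near: n; exists 1%N.
  apply: QE => //; rewrite divr_ge0// -lerBlDl sub0r -[- x]expRK.
  rewrite ler_ln ?posrE ?expR_gt0 ?ltr0n//; near: n; exact: nbhs_infty_ger.
by apply: cvg_EFin; [exact: nearW|exact: max_cdf_gumbel_cvg].
Unshelve. all: by end_near. Qed.
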